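(* Let $\Sigma$ be a support curve and let $c:[a,b]\times[0,T)\to\mathbb R^2$ be a solution of the area preserving curve shortening problem with Neumann free boundary conditions, where the initial curve $c_0$ satisfies: (A) $c_0$ has positive curvature, $\kappa_0>0$ on $[a,b]$; (B) $c_0$ has no self-intersection; (C) $c_0$ is contained in the outer domain created by $\Sigma$; (D) $L(c_0)<{}^{\Sigma}d:=\min\{|x-y|:x,y\in\Sigma,\ {}^{\Sigma}\vec\tau(x)=-{}^{\Sigma}\vec\tau(y)\}$. If in addition $$\int_a^b\kappa\,ds<\pi+\frac{\pi}{2}\qquad\text{for all } t\in[0,T),$$ then the curves stay embedded, i.e. $c(\cdot,t)$ is embedded for every $t\in[0,T)$.
   Context: For a regular planar curve $f$: $\partial_s=|\partial_pf|^{-1}\partial_p$, $ds=|\partial_p f|\,dp$, $\tau=\partial_sf$ is the tangent, $\nu=J\tau$ the normal ($J$ = rotation by $+\frac{\pi}{2}$), $\kappa=\langle\partial_s^2f,\nu\rangle$ the curvature, $L(f)$ the length. $\angle_{\mathbb R^2}(v,w)$ is the oriented angle from $v$ to $w$. A support curve is a smooth, convex, simple, smoothly closed curve ${}^{\Sigma}f:[{}^{\Sigma}a,{}^{\Sigma}b]\to\mathbb R^2$ parametrized by arclength and positively oriented, so that its curvature satisfies ${}^{\Sigma}\kappa\ge 0$. $\Sigma$ denotes its image, ${}^{\Sigma}\vec\tau:\Sigma\to\mathbb S^1$ its unit tangent field, $G_\Sigma$ the bounded domain enclosed by $\Sigma$. The outer domain created by $\Sigma$ is $\mathbb R^2\setminus\overline{G_\Sigma}$;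 an initial curve is ''contained in the outer domain'' if, apart from its endpoints on $\Sigma$, it lies there. An initial curve is a smooth regular curve $c_0:[a,b]\to\mathbb R^2$ with $c_0(a),c_0(b)\in\Sigma$, $\angle_{\mathbb R^2}(\tau_0(a),{}^{\Sigma}\vec\tau(c_0(a)))=\frac{\pi}{2}$ and $\angle_{\mathbb R^2}(\tau_0(b),{}^{\Sigma}\vec\tau(c_0(b)))=-\frac{\pi}{2}$. A solution of the area preserving curve shortening problem with Neumann free boundary conditions with initial curve $c_0$ is a smooth family of smooth regular curves $c:[a,b]\times[0,T)\to\mathbb R^2$ (of class $C^{2+\alpha,1+\alpha/2}$ on $[a,b]\times[0,T)$ for every $\alpha\in(0,1)$ and $C^\infty$ on $[a,b]\times(0,T)$) such that $\partial_tc=(\kappa-\bar\kappa)\nu$, $c(\cdot,0)=c_0$, and for all $t\in[0,T)$: $c(a,t),c(b,t)\in\Sigma$, $\angle_{\mathbb R^2}(\tau(a,t),{}^{\Sigma}\vec\tau(c(a,t)))=\frac{\pi}{2}$, $\angle_{\mathbb R^2}(\tau(b,t),{}^{\Sigma}\vec\tau(c(b,t)))=-\frac{\pi}{2}$. Here $\bar\kappa(t)=\int_a^b\kappa(p,t)\,ds\big/\int_a^b ds$. *)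

(* Defs.v *)
From mathcomp Require Import all_boot all_order all_algebra.
From mathcomp Require Import all_classical all_reals all_analysis.

Set Implicit Arguments.
Unset Strict Implicit.
Unset Printing Implicit Defensive.

Import Order.TTheory GRing.Theory Num.Theory.
Import numFieldNormedType.Exports.

Local Open Scope classical_set_scope.
Local Open Scope ring_scope.

(** ** The Euclidean plane *)

(* The library norm on a product is the sup norm.  It induces the usual topology
   and the usual bounded sets, but lengths must be taken with [enorm]. *)
Definition plane (R : realType) : normedModType R := (R * R)%type.

Definition dot (R : realType) (v w : plane R) : R := v.1 * w.1 + v.2 * w.2.

Definition enorm (R : realType) (v : plane R) : R := Num.sqrt (dot v v).

Definition rot90 (R : realType) (v : plane R) : plane R := (- v.2, v.1).

(* The oriented angle from [v] to [w], in ]-pi, pi]; counterclockwise angles are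
   positive, and [dot (rot90 v) w] is the determinant of (v, w). *)
Definition oangle (R : realType) (v w : plane R) : R :=
  let theta := acos (dot v w / (enorm v * enorm w)) in
  if 0 <= dot (rot90 v) w then theta else - theta.

(** ** Differentiation relative to a subset of the line *)

(* On an interval these are the usual derivatives, one-sided at the endpoints
   which belong to the interval. *)
Definition diff_quot (R : realType) (V : normedModType R) (f : R -> V) (x : R) :
  R -> V := fun y => (y - x)^-1 *: (f y - f x).

Definition derivable_in (R : realType) (V : normedModType R) (D : set R)
  (f : R -> V) (x : R) : Prop := cvg (diff_quot f x @ within D x^').

Definition derive_in (R : realType) (V : normedModType R) (D : set R)
  (f : R -> V) (x : R) : V := lim (diff_quot f x @ within D x^').

Definition derive_in_n (R : realType) (V : normedModType R) (D : set R)
  (n : nat) (f : R -> V) : R -> V := iter n (derive_in D) f.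

Definition smooth_on (R : realType) (V : normedModType R) (D : set R)
  (f : R -> V) : Prop :=
  forall n x, D x -> derivable_in D (derive_in_n D n f) x.

(** ** Geometry of a planar curve [f : I -> R^2] *)

Definition regular (R : realType) (I : set R) (f : R -> plane R) : Prop :=
  forall p, I p -> derive_in I f p <> 0.

Definition speed (R : realType) (I : set R) (f : R -> plane R) (p : R) : R :=
  enorm (derive_in I f p).

Definition arc_derive (R : realType) (I : set R) (f g : R -> plane R) :
  R -> plane R := fun p => (speed I f p)^-1 *: derive_in I g p.

Definition tangent (R : realType) (I : set R) (f : R -> plane R) :
  R -> plane R := arc_derive I f f.

Definition normal (R : realType) (I : set R) (f : R -> plane R) :
  R -> plane R := fun p => rot90 (tangent I f p).

Definition curvature (R : realType) (I : set R) (f : R -> plane R) : R -> R :=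
  fun p => dot (arc_derive I f (tangent I f) p) (normal I f p).

Definition arc_integral (R : realType) (I : set R) (f : R -> plane R)
  (g : R -> R) : R :=
  Rintegral (@lebesgue_measure R) I (fun p => g p * speed I f p).

Definition length (R : realType) (I : set R) (f : R -> plane R) : R :=
  arc_integral I f (fun=> 1).

Definition total_curvature (R : realType) (I : set R) (f : R -> plane R) : R :=
  arc_integral I f (curvature I f).

Definition mean_curvature (R : realType) (I : set R) (f : R -> plane R) : R :=
  total_curvature I f / length I f.

(* An injective immersion; on the compact intervals considered here it is
   automatically a homeomorphism onto its image. *)
Definition embedded (R : realType) (I : set R) (f : R -> plane R) : Prop :=
  regular I f /\ set_inj I f.

(** ** Support curves *)

Section SupportCurve.

Context (R : realType) (sa sb : R) (sf : R -> plane R).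

Local Notation I := (`[sa, sb]%classic : set R).

Definition supp_image : set (plane R) := sf @` I.

(* Every parameter mapped to [x] gives the same value, because a support curve
   is simple and smoothly closed. *)
Definition supp_tangent (x : plane R) : plane R :=
  tangent I sf (xget sa [set s | I s /\ sf s = x]).

(* By the Jordan curve theorem, the complement of the image of a simple closed
   curve has exactly one bounded component. *)
Definition supp_inside : set (plane R) :=
  [set x | (~` supp_image) x /\
           bounded_set (connected_component (~` supp_image) x)].

Definition supp_outside : set (plane R) := ~` closure supp_inside.

Definition one_side_of_tangents : Prop :=
  forall s, I s ->
    (forall u, I u -> 0 <= dot (sf u - sf s) (normal I sf s)) \/
    (forall u, I u -> dot (sf u - sf s) (normal I sf s) <= 0).

(* The enclosed domain lies to the left of the curve. *)
Definition positively_oriented : Prop :=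
  forall s, I s ->
    \forall h \near 0^'+, supp_inside (sf s + h *: normal I sf s).

Record support_curve : Prop := SupportCurve {
  supp_lt : sa < sb;
  supp_smooth : smooth_on I sf;
  supp_arclength : forall s, I s -> enorm (derive_in I sf s) = 1;
  supp_closed : forall n, derive_in_n I n sf sa = derive_in_n I n sf sb;
  supp_simple : set_inj `[sa, sb[ sf;
  supp_convex : one_side_of_tangents;
  supp_oriented : positively_oriented;
  supp_curvature : forall s, I s -> 0 <= curvature I sf s
}.

Definition antipodal_distances : set R :=
  [set r | exists x y, [/\ supp_image x, supp_image y,
     supp_tangent x = - supp_tangent y & r = enorm (x - y)]].

(* A curve on [a, b] with endpoints on the support curve, leaving it
   perpendicularly outwards and coming back perpendicularly inwards. *)
Definition neumann_boundary (a b : R) (f : R -> plane R) : Prop :=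
  [/\ supp_image (f a), supp_image (f b),
      oangle (tangent `[a, b] f a) (supp_tangent (f a)) = pi / 2 &
      oangle (tangent `[a, b] f b) (supp_tangent (f b)) = - (pi / 2)].

Record initial_curve (a b : R) (c0 : R -> plane R) : Prop := InitialCurve {
  init_smooth : smooth_on `[a, b] c0;
  init_regular : regular `[a, b] c0;
  init_boundary : neumann_boundary a b c0
}.

Definition in_outer_domain (a b : R) (f : R -> plane R) : Prop :=
  forall p, `]a, b[%classic p -> supp_outside (f p).

End SupportCurve.

Definition is_minimum (R : realType) (A : set R) (d : R) : Prop :=
  A d /\ lbound A d.

(** ** Families of curves [c : I x J -> R^2], [c p t] *)

Definition dspace (R : realType) (I : set R) (c : R -> R -> plane R) :
  R -> R -> plane R := fun p t => derive_in I (c ^~ t) p.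

Definition dtime (R : realType) (J : set R) (c : R -> R -> plane R) :
  R -> R -> plane R := fun p t => derive_in J (c p) t.

Definition has_dspace (R : realType) (I J : set R) (c : R -> R -> plane R) :
  Prop := forall p t, I p -> J t -> derivable_in I (c ^~ t) p.

Definition has_dtime (R : realType) (I J : set R) (c : R -> R -> plane R) :
  Prop := forall p t, I p -> J t -> derivable_in J (c p) t.

Definition jointly_continuous (R : realType) (I J : set R)
  (c : R -> R -> plane R) : Prop :=
  {within I `*` J, continuous (fun z : R * R => c z.1 z.2)}.

Fixpoint class_C (R : realType) (I J : set R) (k : nat)
  (c : R -> R -> plane R) : Prop :=
  jointly_continuous I J c /\
  if k is k'.+1 then
    [/\ has_dspace I J c, has_dtime I J c,
        class_C I J k' (dspace I c) & class_C I J k' (dtime J c)]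
  else True.

Definition smooth_family (R : realType) (I J : set R) (c : R -> R -> plane R) :
  Prop := forall k, class_C I J k c.

Definition holder_space (R : realType) (I J : set R) (al : R)
  (c : R -> R -> plane R) : Prop :=
  exists K : R, forall p q t, I p -> I q -> J t ->
    enorm (c p t - c q t) <= K * `|p - q| `^ al.

Definition holder_time (R : realType) (I J : set R) (al : R)
  (c : R -> R -> plane R) : Prop :=
  exists K : R, forall p t u, I p -> J t -> J u ->
    enorm (c p t - c p u) <= K * `|t - u| `^ al.

(* [0, T) and (0, T), where T = +oo is allowed. *)
Definition time_ico (R : realType) (T : \bar R) : set R :=
  [set t | 0 <= t /\ (t%:E < T)%E].

Definition time_ioo (R : realType) (T : \bar R) : set R :=
  [set t | 0 < t /\ (t%:E < T)%E].

(* The parabolic Hoelder class C^{2+al, 1+al/2} on I x [0, T).  As [0, T) is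
   half-open, the Hoelder seminorms are required to be finite on I x [0, T'] for
   every T' < T, and nothing is imposed as t tends to T. *)
Definition parabolic_holder (R : realType) (I : set R) (T : \bar R) (al : R)
  (c : R -> R -> plane R) : Prop :=
  let J := time_ico T in
  let c_p := dspace I c in
  let c_pp := dspace I c_p in
  let c_t := dtime J c in
  [/\ has_dspace I J c, has_dspace I J c_p & has_dtime I J c] /\
  [/\ jointly_continuous I J c, jointly_continuous I J c_p,
      jointly_continuous I J c_pp & jointly_continuous I J c_t] /\
  forall T' : R, J T' ->
    [/\ holder_space I `[0, T'] al c_pp, holder_space I `[0, T'] al c_t,
        holder_time I `[0, T'] (al / 2) c_pp,
        holder_time I `[0, T'] (al / 2) c_t &
        holder_time I `[0, T'] ((1 + al) / 2) c_p].

(** ** The area preserving flow with Neumann free boundary conditions *)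

Record apcsf_solution (R : realType) (sa sb : R) (sf : R -> plane R) (a b : R)
  (c0 : R -> plane R) (T : \bar R) (c : R -> R -> plane R) : Prop :=
  ApcsfSolution {
  sol_holder : forall al : R, 0 < al < 1 -> parabolic_holder `[a, b] T al c;
  sol_smooth : smooth_family `[a, b] (time_ioo T) c;
  sol_regular : forall t, time_ico T t -> regular `[a, b] (c ^~ t);
  sol_flow : forall p t, `[a, b]%classic p -> time_ico T t ->
    dtime (time_ico T) c p t =
    (curvature `[a, b] (c ^~ t) p - mean_curvature `[a, b] (c ^~ t))
      *: normal `[a, b] (c ^~ t) p;
  sol_initial : forall p, `[a, b]%classic p -> c p 0 = c0 p;
  sol_boundary : forall t, time_ico T t ->
    neumann_boundary sa sb sf a b (c ^~ t)
}.

(* Main.v *)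
Require Import Defs.
From mathcomp Require Import all_boot all_order all_algebra.
From mathcomp Require Import all_classical all_reals all_analysis.
From mathcomp Require Import ring lra.
Import Order.TTheory GRing.Theory Num.Theory.
Import numFieldNormedType.Exports.
Set Implicit Arguments.
Unset Strict Implicit.
Unset Printing Implicit Defensive.
Local Open Scope classical_set_scope.
Local Open Scope ring_scope.

(** Two facts give the result.

    (1) [kappa >= 0] is preserved.  Along the flow [kappa] satisfies a parabolic
    equation [kappa_t = kappa_ss + kappa^2 (kappa - kbar)].  Since the image of a
    support curve lies in all its supporting half-planes, its normals are monotone, and
    since the moving endpoints slide along it this yields the boundary inequality
    [(kappa - kbar) kappa_s >= 0] at [a] and [<= 0] at [b].  Minimise
    [kappa * exp(- lam t) / g] with [g p = 1 + (p - (a + b) / 2)^2].  At a negative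
    minimum on the boundary [kappa] lies below all its other values, because [g] is
    maximal there, hence below its mean [kbar]; so the sign of [kappa_s] contradicts
    the slope of [g].  In the interior a large [lam] contradicts the equation; the
    bound on the total curvature bounds [kbar] from above.

    (2) A curve with [kappa >= 0], total curvature less than [3 pi / 2] and Neumann
    boundary conditions is injective.  A loop from [p] to [q] turns by more than [pi],
    so the pieces before [p] and after [q] turn by less than [pi / 2] in total.  Hence
    [det (tau p, c b - c a) <= 0], whereas [c b - c a] lies in the intersection of the
    supporting half-planes at the two endpoints, on which this determinant is positive. *)

(** * Derivatives relative to a subset of the line *)

Section RelativeDerivative.
Context {R : realType}.
Implicit Types (D : set R) (f g : R -> R) (x l m : R).

(** A relation instead of the total function [derive_in]: it records that the limit exists together
    with its value. Plane-valued maps are treated coordinate by coordinate. *)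
Definition deriv_at D f x l : Prop := diff_quot f x @ within D x^' --> l.

Lemma deriv_atE D f x l : deriv_at D f x l <->
  (fun y => (f y - f x) / (y - x)) @ within D x^' --> l.
Proof.
rewrite /deriv_at; have -> // : diff_quot f x = fun y => (f y - f x) / (y - x).
by apply/funext => y; rewrite /diff_quot /GRing.scale /= mulrC.
Qed.

Lemma deriv_at_val D f x l m : deriv_at D f x l -> l = m -> deriv_at D f x m.
Proof. by move=> h <-. Qed.

Lemma near_within_dnbhs D x (P : R -> Prop) : (forall y, D y -> y != x -> P y) ->
  \forall y \near within D x^', P y.
Proof.
move=> h; have : \forall y \near x^', y != x by exact: nbhs_dnbhs_neq.
by apply: (@filterS _ (x^')) => y yx Dy; exact: h.
Qed.

Lemma deriv_at_ext D f g x l : (forall y, D y -> f y = g y) -> D x ->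
  deriv_at D f x l -> deriv_at D g x l.
Proof.
move=> fg Dx /deriv_atE h; apply/deriv_atE; apply: cvg_trans h.
apply: near_eq_cvg; apply: near_within_dnbhs => y Dy _.
by rewrite !fg.
Qed.

Lemma deriv_at_sub D E f x l : E `<=` D -> deriv_at D f x l -> deriv_at E f x l.
Proof.
move=> ED h A lA; have := h _ lA; rewrite /nbhs /= /within /=.
by apply: filterS => y hy /ED.
Qed.

Lemma deriv_at_unique D f x l m : ProperFilter (within D x^') ->
  deriv_at D f x l -> deriv_at D f x m -> l = m.
Proof. by move=> PF; apply: cvg_unique; exact: norm_hausdorff. Qed.

Lemma deriv_at_cvg D f x l : deriv_at D f x l -> f @ within D x^' --> f x.
Proof.
move=> /deriv_atE h.
have h2 : (fun y => (f y - f x) / (y - x) * (y - x) + f x) @ within D x^' --> l * 0 + f x.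
  apply: cvgD; last exact: cvg_cst.
  apply: cvgM => //; rewrite -(subrr x); apply: cvgB; last exact: cvg_cst.
  by apply: cvg_trans (cvg_within _) _; exact: cvg_within.
rewrite mulr0 add0r in h2; apply: cvg_trans h2.
apply: near_eq_cvg; apply: near_within_dnbhs => y _ yx.
by rewrite divfK ?subrK// subr_eq0.
Qed.

Lemma deriv_at_cont D f x l : deriv_at D f x l -> f @ within D (nbhs x) --> f x.
Proof.
move=> /deriv_at_cvg h A fA.
have := h _ fA; have := nbhs_singleton fA.
rewrite /nbhs /= /within /= /dnbhs /within /= => Ax.
apply: (@filterS _ (nbhs x)) => y hy Dy; have [->//|yx] := eqVneq y x.
exact: hy.
Qed.

Lemma deriv_at_cst D c x : deriv_at D (fun=> c) x 0.
Proof.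
apply/deriv_atE; under eq_fun do rewrite subrr mul0r; exact: cvg_cst.
Qed.

Lemma deriv_at_id D x : deriv_at D id x 1.
Proof.
apply/deriv_atE.
have h : (fun=> 1:R) @ within D x^' --> (1:R) by exact: cvg_cst.
apply: cvg_trans h; apply: near_eq_cvg; apply: near_within_dnbhs => y _ yx.
by rewrite divff// subr_eq0.
Qed.

Lemma deriv_atD D f g x l m : deriv_at D f x l -> deriv_at D g x m ->
  deriv_at D (fun y => f y + g y) x (l + m).
Proof.
move=> /deriv_atE hf /deriv_atE hg; apply/deriv_atE.
under eq_fun do rewrite opprD addrACA mulrDl.
exact: cvgD.
Qed.

Lemma deriv_atN D f x l : deriv_at D f x l -> deriv_at D (fun y => - f y) x (- l).
Proof.
move=> /deriv_atE hf; apply/deriv_atE.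
under eq_fun do rewrite -opprD mulNr.
exact: cvgN.
Qed.

Lemma deriv_atB D f g x l m : deriv_at D f x l -> deriv_at D g x m ->
  deriv_at D (fun y => f y - g y) x (l - m).
Proof. by move=> hf hg; apply: deriv_atD => //; exact: deriv_atN. Qed.

Lemma deriv_atM D f g x l m : deriv_at D f x l -> deriv_at D g x m ->
  deriv_at D (fun y => f y * g y) x (l * g x + f x * m).
Proof.
move=> /deriv_atE hf hg; apply/deriv_atE.
have -> : (fun y => (f y * g y - f x * g x) / (y - x)) =
  (fun y => (f y - f x) / (y - x) * g y + f x * ((g y - g x) / (y - x))).
  by apply/funext => y; ring.
apply: cvgD; apply: cvgM => //; [exact: deriv_at_cvg hg|exact: cvg_cst|exact/deriv_atE].
Qed.

Lemma deriv_atX D f x l n : deriv_at D f x l ->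
  deriv_at D (fun y => f y ^+ n) x (n%:R * f x ^+ n.-1 * l).
Proof.
move=> h; elim: n => [|n IH]; first by rewrite !mul0r; exact: deriv_at_cst.
rewrite (_ : (fun y => _) = fun y => f y * f y ^+ n); last first.
  by apply/funext => y; rewrite exprS.
apply: (deriv_at_val (deriv_atM h IH)).
by case: n {IH} => [|n] /=; rewrite ?exprS; ring.
Qed.

Lemma deriv_at_comp D (h : R -> R) f x l m : deriv_at D f x l ->
  is_derive (f x) (1:R) h m -> deriv_at D (fun y => h (f y)) x (m * l).
Proof.
move=> hf [dh hm].
(* Caratheodory's slope function: extended by [m] at [f x] it is continuous there, so points [y]
   with [f y = f x] cause no division problem. *)
pose phi z := if z == f x then m else (h z - h (f x)) / (z - f x).
have cphi : phi @ nbhs (f x) --> phi (f x).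
  rewrite {2}/phi eqxx.
  have : (fun z => (h z - h (f x)) / (z - f x)) @ (f x)^' --> m.
    have := dh; rewrite /derivable => /cvg_ex[/= m' hm'].
    have mm' : m = m' by rewrite -hm; apply/cvg_lim.
    rewrite -mm' in hm'.
    rewrite (_ : (fun z => _) = (fun k => k^-1 *: (h (k *: 1 + f x) - h (f x))) \o (fun z => z - f x)); last first.
      by apply/funext => z /=; rewrite [_ *: 1]mulr1 subrK mulrC.
    apply: cvg_comp hm'.
    move=> A [e /= e0 he]; exists e => //= z zx zfx; apply: he => /=; last by rewrite subr_eq0.
    by rewrite sub0r normrN distrC.
  move=> hc A mA; have := hc _ mA; rewrite /nbhs /= /dnbhs /within /=.
  apply: (@filterS _ (nbhs (f x))) => z hz.
  rewrite /= /phi; case: (eqVneq z (f x)) => [_|]; last exact: hz.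
  exact: nbhs_singleton.
apply/deriv_atE.
rewrite (_ : (fun y => _) = fun y => phi (f y) * ((f y - f x) / (y - x))); last first.
  apply/funext => y; rewrite /phi; case: (eqVneq (f y) (f x)) => [->|yx]; first by rewrite !subrr !mul0r mulr0.
  by rewrite mulrA divfK// subr_eq0.
apply: cvgM; last exact/deriv_atE.
have -> : m = phi (f x) by rewrite /phi eqxx.
by apply: cvg_comp cphi; exact: deriv_at_cvg hf.
Qed.

Lemma deriv_at_is_derive D f x l : nbhs x D -> deriv_at D f x l ->
  is_derive x (1:R) f l.
Proof.
move=> nD /deriv_atE h.
have h2 : (fun y => (f y - f x) / (y - x)) @ x^' --> l.
  move=> A lA; have := h _ lA; rewrite /nbhs /= /within /= /dnbhs /within /=.
  apply: (@filterS2 _ (nbhs x) _ _ _ _ _ nD) => y Dy hy yx; exact: hy.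
have h3 : (fun k => k^-1 *: (f (k *: 1 + x) - f x)) @ 0^' --> l.
  rewrite (_ : (fun z => _) = (fun y => (f y - f x) / (y - x)) \o (fun k => k + x)); last first.
    by apply/funext => z /=; rewrite [_ *: 1]mulr1 addrK mulrC.
  apply: cvg_comp h2.
  move=> A [e /= e0 he]; exists e => //= z zx zfx; apply: he => /=; last by rewrite -subr_eq0 addrK.
  rewrite (_ : x - (z + x) = 0 - z)//; ring.
apply: DeriveDef; first by apply/cvg_ex; exists l.
exact/cvg_lim.
Qed.

Lemma is_derive_deriv_at D f x l : is_derive x (1:R) f l -> deriv_at D f x l.
Proof.
move=> h; have := deriv_at_comp (@deriv_at_id D x) h; by rewrite mulr1.
Qed.

(** At an interior point of [E] the relative derivative is the ordinary one, hence serves every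
    other set [D]. *)
Lemma deriv_at_nbhs D E f x l :
  nbhs x E -> deriv_at E f x l -> deriv_at D f x l.
Proof.
by move=> nE h; apply: is_derive_deriv_at; exact: deriv_at_is_derive h.
Qed.

Lemma within_continuousM (T : topologicalType) (D : set T) (g h : T -> R) :
  {within D, continuous g} -> {within D, continuous h} ->
  {within D, continuous (fun z => g z * h z)}.
Proof.
move=> /subspace_continuousP cg /subspace_continuousP ch; apply/subspace_continuousP => x Dx.
by apply: cvgM; [exact: cg|exact: ch].
Qed.

Lemma within_continuousB (T : topologicalType) (D : set T) (g h : T -> R) :
  {within D, continuous g} -> {within D, continuous h} ->
  {within D, continuous (fun z => g z - h z)}.
Proof.
move=> /subspace_continuousP cg /subspace_continuousP ch; apply/subspace_continuousP => x Dx.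
by apply: cvgB; [exact: cg|exact: ch].
Qed.

Lemma plane_cvgP (T : Type) (F : set_system T) (FF : Filter F) (h : T -> plane R)
  (v : plane R) : h @ F --> v <->
  (fun z => (h z).1) @ F --> v.1 /\ (fun z => (h z).2) @ F --> v.2.
Proof.
split=> [hv|[h1 h2]].
- split; [apply: (@cvg_comp _ _ _ h fst F (nbhs v) _ hv)|apply: (@cvg_comp _ _ _ h snd F (nbhs v) _ hv)].
  + by case: v {hv} => v w; exact: (@cvg_fst _ _ (nbhs v) (nbhs w)).
  + by case: v {hv} => v w; exact: (@cvg_snd _ _ (nbhs v) (nbhs w)).
- case: v h1 h2 => v w h1 h2 S [[U V] /= [vU wV] UV].
  have := h1 _ vU; have := h2 _ wV; apply: (@filterS2 _ F) => z hV hU.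
  by apply: UV.
Qed.

Lemma derivable_in_deriv_at D (f : R -> plane R) x : derivable_in D f x ->
  deriv_at D (fun z => (f z).1) x (derive_in D f x).1 /\
  deriv_at D (fun z => (f z).2) x (derive_in D f x).2.
Proof.
by move=> h; have := h : diff_quot f x @ within D x^' --> derive_in D f x; move/plane_cvgP.
Qed.

Lemma derive_in_pair D (f : R -> plane R) x l m : ProperFilter (within D x^') ->
  deriv_at D (fun z => (f z).1) x l -> deriv_at D (fun z => (f z).2) x m ->
  derive_in D f x = (l, m).
Proof.
move=> PF h1 h2; apply: cvg_lim; first exact: norm_hausdorff.
by apply/plane_cvgP.
Qed.

Lemma derive_in_ext (V : normedModType R) D (f g : R -> V) x :
  (forall y, D y -> f y = g y) -> D x -> derive_in D f x = derive_in D g x.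
Proof.
move=> fg Dx; rewrite /derive_in; congr (lim _); apply/funext => S; apply/propext.
by split; rewrite /nbhs /= /within /=; apply: (@filterS _ (x^')) => y + Dy => /(_ Dy);
  rewrite /diff_quot /= !fg.
Qed.

End RelativeDerivative.

(* Keeps conversion from unfolding the filters. *)
#[global] Opaque deriv_at derive_in.

(** * Mean value theorem, extrema and antiderivatives on intervals *)

Section IntervalCalculus.
Context {R : realType}.
Implicit Types (D : set R) (f g : R -> R) (a b x l m : R).

Lemma within_dnbhs_proper D x :
  (forall e, 0 < e -> exists2 y, D y & y != x /\ `|x - y| < e) ->
  ProperFilter (within D x^').
Proof.
move=> h; split; last exact: within_filter.
rewrite /within /= /dnbhs /within /= => -[e /= e0 he].
by have [y Dy [yx xy]] := h _ e0; exact: (he y).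
Qed.

(** Points of a nondegenerate interval are accumulation points of it, including the ends; this makes
    one-sided derivatives there unique. *)
Lemma itv_dnbhs_proper a b x : a < b -> `[a, b]%classic x ->
  ProperFilter (within `[a, b] x^').
Proof.
move=> ab; rewrite /= in_itv /= => /andP[ax xb].
apply: within_dnbhs_proper => e e0.
have [xb'|bx] := ltP x b.
- pose d := Num.min e (b - x).
  have d0 : 0 < d by rewrite lt_min e0 subr_gt0.
  have de : d <= e by rewrite ge_min lexx.
  have db : d <= b - x by rewrite ge_min lexx orbT.
  exists (x + d / 2); first by rewrite /= in_itv /=; apply/andP; split; lra.
  split; first by apply/eqP; lra.
  by rewrite distrC ger0_norm; lra.
- pose d := Num.min e (x - a).
  have d0 : 0 < d by rewrite lt_min e0 subr_gt0 (lt_le_trans ab).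
  have de : d <= e by rewrite ge_min lexx.
  have db : d <= x - a by rewrite ge_min lexx orbT.
  exists (x - d / 2); first by rewrite /= in_itv /=; apply/andP; split; lra.
  split; first by apply/eqP; lra.
  by rewrite ger0_norm; lra.
Qed.

Lemma nbhs_dnbhs_proper D x : nbhs x D -> ProperFilter (within D x^').
Proof.
move=> [e /= e0 he]; apply: within_dnbhs_proper => d d0.
pose r := Num.min e d.
have r0 : 0 < r by rewrite lt_min e0.
have re : r <= e by rewrite ge_min lexx.
have rd : r <= d by rewrite ge_min lexx orbT.
exists (x + r / 2); first by apply: he; rewrite /= distrC ger0_norm; lra.
split; first by apply/eqP; lra.
by rewrite distrC ger0_norm; lra.
Qed.

Lemma deriv_at_within_continuous D f (df : R -> R) :
  (forall x, D x -> deriv_at D f x (df x)) -> {within D, continuous f}.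
Proof.
by move=> h; apply/subspace_continuousP => x Dx; exact: deriv_at_cont (h x Dx).
Qed.

Lemma deriv_at_MVT a b f (df : R -> R) : a < b ->
  (forall x, a <= x <= b -> deriv_at `[a, b] f x (df x)) ->
  exists2 x, a < x < b & f b - f a = df x * (b - a).
Proof.
move=> ab h; have [||x xab ->] := @MVT R f df a b ab.
- move=> x; rewrite in_itv /= => /andP[ax xb].
  apply: (@deriv_at_is_derive _ `[a, b]); last by apply: h; rewrite !ltW.
  have /near_in_itvoo : x \in `]a, b[ by rewrite in_itv /= ax.
  by apply: filterS => y; rewrite /= !in_itv /= => /andP[ay yb]; rewrite !ltW.
- apply: (@deriv_at_within_continuous _ _ df) => x; rewrite /= in_itv; exact: h.
- by exists x => //; rewrite in_itv in xab.
Qed.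

Lemma deriv_at_ge0_le a b f (df : R -> R) : a <= b ->
  (forall x, a <= x <= b -> deriv_at `[a, b] f x (df x)) ->
  (forall x, a < x < b -> 0 <= df x) -> f a <= f b.
Proof.
rewrite le_eqVlt => /predU1P[->//|ab] h df0.
have [x xab fab] := deriv_at_MVT ab h.
by rewrite -subr_ge0 fab mulr_ge0 ?df0// subr_ge0 ltW.
Qed.

Lemma deriv_at_gt0_lt a b f (df : R -> R) : a < b ->
  (forall x, a <= x <= b -> deriv_at `[a, b] f x (df x)) ->
  (forall x, a < x < b -> 0 < df x) -> f a < f b.
Proof.
move=> ab h df0; have [x xab fab] := deriv_at_MVT ab h.
by rewrite -subr_gt0 fab mulr_gt0 ?df0// subr_gt0.
Qed.

Lemma deriv_at_eq0_cst a b f : a <= b ->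
  (forall x, a <= x <= b -> deriv_at `[a, b] f x 0) -> f a = f b.
Proof.
rewrite le_eqVlt => /predU1P[->//|ab] h.
have [x xab] := deriv_at_MVT (df := fun=> 0) ab h.
by rewrite mul0r => /eqP; rewrite subr_eq0 => /eqP.
Qed.

Lemma deriv_at_min_right D f x l : ProperFilter (within D x^') ->
  (forall y, D y -> x <= y /\ f x <= f y) -> deriv_at D f x l -> 0 <= l.
Proof.
move=> PF h /deriv_atE /cvgr_to_ge; apply; apply: near_within_dnbhs => y /h[xy fxy] _.
by rewrite divr_ge0// subr_ge0.
Qed.

Lemma deriv_at_min_left D f x l : ProperFilter (within D x^') ->
  (forall y, D y -> y <= x /\ f x <= f y) -> deriv_at D f x l -> l <= 0.
Proof.
move=> PF h /deriv_atE /cvgr_to_le; apply; apply: near_within_dnbhs => y /h[xy fxy] _.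
by rewrite mulr_ge0_le0 ?invr_le0 ?subr_ge0 ?subr_le0.
Qed.

(** Restricting to either side of the minimum gives both signs of [df x]. If [l < 0], then [df < 0]
    just to the right of [x], and the mean value theorem yields a value below [f x]. *)
Lemma second_deriv_at_min a b f (df : R -> R) x l : a < x < b ->
  (forall y, a <= y <= b -> deriv_at `[a, b] f y (df y)) ->
  deriv_at `[a, b] df x l ->
  (forall y, a <= y <= b -> f x <= f y) -> df x = 0 /\ 0 <= l.
Proof.
move=> /andP[ax xb] hf hdf fmin.
have xab : a <= x <= b by rewrite !ltW.
have df0 : df x = 0.
  apply/eqP; rewrite eq_le; apply/andP; split.
  - apply: (@deriv_at_min_left `[a, x] f x).
    + by apply: itv_dnbhs_proper => //; rewrite /= in_itv /= lexx ltW.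
    + move=> y; rewrite /= in_itv /= => /andP[ay yx]; split=> //.
      by apply: fmin; rewrite ay (le_trans yx) ?ltW.
    + apply: deriv_at_sub (hf _ xab) => y; rewrite /= !in_itv /= => /andP[-> yx].
      by rewrite (le_trans yx) ?ltW.
  - apply: (@deriv_at_min_right `[x, b] f x).
    + by apply: itv_dnbhs_proper => //; rewrite /= in_itv /= lexx ltW.
    + move=> y; rewrite /= in_itv /= => /andP[xy yb]; split=> //.
      by apply: fmin; rewrite yb (le_trans _ xy) ?ltW.
    + apply: deriv_at_sub (hf _ xab) => y; rewrite /= !in_itv /= => /andP[xy ->].
      by rewrite (le_trans _ xy) ?ltW.
split=> //; rewrite leNgt; apply/negP => l0.
move/deriv_atE : hdf => /cvgr_lt /(_ _ l0).
rewrite /within /= /dnbhs /within /= => -[e /= e0 he].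
pose r := Num.min e (b - x).
have r0 : 0 < r by rewrite lt_min e0 subr_gt0.
have re : r <= e by rewrite ge_min lexx.
have rb : r <= b - x by rewrite ge_min lexx orbT.
pose z := x + r / 2.
have xz : x < z by rewrite /z; lra.
have zb : z <= b by rewrite /z; lra.
have [|y /andP[xy yz] fzx] := @deriv_at_MVT x z f df xz.
  move=> y /andP[xy yz]; apply: (@deriv_at_sub _ `[a, b]).
    move=> u; rewrite /= !in_itv /= => /andP[xu uz]; apply/andP; split; lra.
  apply: hf; apply/andP; split; lra.
have : f x <= f z by apply: fmin; apply/andP; split; lra.
rewrite -subr_ge0 fzx pmulr_lge0 ?subr_gt0//.
have := he y; rewrite /= distrC gtr0_norm ?subr_gt0// df0 subr0.
move=> H; rewrite leNgt; apply/negP; rewrite negbK.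
have : df y / (y - x) < 0.
  apply: H; first by rewrite /z in yz; lra.
  - by rewrite gt_eqF.
  - by rewrite in_itv /=; apply/andP; split; lra.
by rewrite pmulr_llt0// invr_gt0 subr_gt0.
Qed.

Lemma antiderivative a b f : a < b -> {within `[a, b], continuous f} ->
  exists F : R -> R, [/\ F a = 0, F b = Rintegral (@lebesgue_measure R) `[a, b] f &
    forall x, a <= x <= b -> deriv_at `[a, b] F x (f x)].
Proof.
(* Clamping the argument extends [f] continuously to the whole line, so the integral function has a
   two-sided derivative even at [a] and [b]. *)
move=> ab cf; pose g x := f (Num.max a (Num.min b x)).
have gE x : a <= x <= b -> g x = f x.
  by move=> /andP[ax xb]; rewrite /g min_r// max_r.
have cg : continuous g.
  move=> x; pose k (y : R) := Num.max a (Num.min b y).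
  have kab y : `[a, b]%classic (k y).
    by rewrite /= in_itv /= /k le_max lexx ge_max ge_min lexx (ltW ab).
  have ck : k @ nbhs x --> k x.
    by apply: continuous_max; [exact: cst_continuous|apply: continuous_min; [exact: cst_continuous|]].
  move/subspace_continuousP : cf => /(_ _ (kab x)); apply: cvg_comp.
  move=> A; rewrite /nbhs /= /within /= => /ck; rewrite /nbhs /=.
  by apply: (@filterS _ (nbhs x)) => y; apply; exact: kab.
have ig u v : u < v -> (@lebesgue_measure R).-integrable `[u, v] (EFin \o g).
  move=> uv; apply: continuous_compact_integrable; first exact: segment_compact.
  exact: continuous_subspaceT.
(* The lower limit [a - 1] makes [a] an interior point of the domain of integration. *)
pose G x := (\int[@lebesgue_measure R]_(t in `[a - 1, x]) (g t))%R.
have dG x : a <= x <= b -> is_derive x (1:R) G (g x).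
  move=> /andP[ax xb].
  have [||||dG <-] := @continuous_FTC1_closed R g (a - 1) x (b + 1).
  + lra.
  + by apply: ig; lra.
  + lra.
  + exact: cg.
  by rewrite derive1E; exact: derivableP.
have dGi x : a <= x <= b -> deriv_at `[a, b] G x (f x).
  by move=> xab; rewrite -gE//; apply: is_derive_deriv_at; exact: dG.
exists (fun x => G x - G a); split; first by rewrite subrr.
- rewrite /Rintegral (@continuous_FTC2 R f G a b ab)//.
  + have cG : {within `[a, b], continuous G}.
      by apply: (deriv_at_within_continuous (df := f)) => x; rewrite /= in_itv; exact: dGi.
    have [_ Ga Gb] := (continuous_within_itvP G ab).1 cG; split=> // x; rewrite in_itv /= => /andP[ax xb].
    by have [|//] := dG x _; rewrite !ltW.
  + move=> x; rewrite in_itv /= => /andP[ax xb].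
    have xab : a <= x <= b by rewrite !ltW.
    by rewrite derive1E -gE//; have [] := dG x xab.
- by move=> x xab; rewrite -[f x]subr0; apply: deriv_atB; [exact: dGi|exact: deriv_at_cst].
Qed.

End IntervalCalculus.

(** * Geometry of support curves and of convex arcs *)

Section PlaneCurves.
Context {R : realType}.
Implicit Types (D : set R) (f g : R -> plane R) (a b x l m : R).

Lemma dot_gt0 (v : plane R) : v <> 0 -> 0 < dot v v.
Proof.
case: v => v w h; rewrite /dot /= lt_neqAle addr_ge0 -?expr2 ?sqr_ge0// andbT eq_sym.
rewrite paddr_eq0 ?sqr_ge0// !expf_eq0 /=; apply/negP => /andP[/eqP v0 /eqP w0].
by apply: h; rewrite v0 w0.
Qed.

Lemma deriv_at_invsqrt D (q : R -> R) x l : 0 < q x -> deriv_at D q x l ->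
  deriv_at D (fun y => (Num.sqrt (q y))^-1) x (- (Num.sqrt (q x))^-1 ^+ 3 * l / 2).
Proof.
move=> q0 hq.
have s0 : Num.sqrt (q x) != 0 by rewrite gt_eqF// sqrtr_gt0.
have h := @is_deriveV R Num.sqrt (q x) _ 1 s0 (is_derive1_sqrt q0).
have := deriv_at_comp hq h.
congr deriv_at; rewrite /GRing.scale /=; field; exact: s0.
Qed.

Lemma deriv_at_invenorm D (u : R -> plane R) x l m : u x <> 0 ->
  deriv_at D (fun y => (u y).1) x l -> deriv_at D (fun y => (u y).2) x m ->
  deriv_at D (fun y => (enorm (u y))^-1) x
    (- (enorm (u x))^-1 ^+ 3 * ((u x).1 * l + (u x).2 * m)).
Proof.
move=> ux h1 h2.
have hq := deriv_atD (deriv_atM h1 h1) (deriv_atM h2 h2).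
apply: (deriv_at_val (@deriv_at_invsqrt D (fun z => dot (u z) (u z)) x _ (dot_gt0 ux) hq)).
by rewrite /enorm; move: (u x) => v; set s := (Num.sqrt _)^-1; field.
Qed.

Section Curve.
Variables (a b : R) (ab : a < b) (f : R -> plane R).
Local Notation I := (`[a, b]%classic : set R).
Local Notation A := (derive_in I f).
Local Notation B := (derive_in I A).
Hypothesis df : forall p, I p -> derivable_in I f p.
Hypothesis ddf : forall p, I p -> derivable_in I A p.
Hypothesis regf : regular I f.
Local Notation r p := (speed I f p)^-1.

Lemma speed_gt0 p : I p -> 0 < speed I f p.
Proof. by move=> Ip; rewrite /speed /enorm sqrtr_gt0 dot_gt0//; exact: regf. Qed.

Lemma speed_sqr p : speed I f p ^+ 2 = (A p).1 ^+ 2 + (A p).2 ^+ 2.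
Proof. by rewrite /speed /enorm sqr_sqrtr ?/dot -?expr2// addr_ge0// sqr_ge0. Qed.

Lemma invspeed_deriv p : I p -> deriv_at I (fun p => r p) p
  (- r p ^+ 3 * ((A p).1 * (B p).1 + (A p).2 * (B p).2)).
Proof.
move=> Ip; have [h1 h2] := derivable_in_deriv_at (ddf Ip).
exact: deriv_at_invenorm (regf Ip) h1 h2.
Qed.

Lemma tangent_deriv p : I p ->
  let r1 := - r p ^+ 3 * ((A p).1 * (B p).1 + (A p).2 * (B p).2) in
  deriv_at I (fun z => (tangent I f z).1) p (r1 * (A p).1 + r p * (B p).1) /\
  deriv_at I (fun z => (tangent I f z).2) p (r1 * (A p).2 + r p * (B p).2).
Proof.
move=> Ip r1; have [h1 h2] := derivable_in_deriv_at (ddf Ip).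
by split; apply: deriv_atM => //; exact: invspeed_deriv.
Qed.

(** The derivative of [r] contributes a multiple of [A], which is orthogonal to the normal; what
    remains is the determinant of the first two derivatives over the cubed speed. *)
Lemma curvatureE p : I p -> curvature I f p =
  ((A p).1 * (B p).2 - (A p).2 * (B p).1) * r p ^+ 3.
Proof.
move=> Ip; have [h1 h2] := tangent_deriv Ip.
rewrite /curvature /arc_derive (derive_in_pair (itv_dnbhs_proper ab Ip) h1 h2).
rewrite /normal /tangent /arc_derive /dot /rot90.
move: (A p) (B p) (r p) => [u1 u2] [v1 v2] s /=.
by rewrite /GRing.scale /=; ring.
Qed.

End Curve.

(** The dot product [c] and the determinant [k] satisfy [c^2 + k^2 = 1]. A right angle forces
    [c = 0], and the branch taken in [oangle] fixes the sign of [k]. *)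
Lemma oangle_perp (v w : plane R) : dot v v = 1 -> dot w w = 1 ->
  (oangle v w = pi / 2 -> w = rot90 v) /\ (oangle v w = - (pi / 2) -> w = - rot90 v).
Proof.
case: v w => [v1 v2] [w1 w2]; rewrite /oangle /enorm /rot90 /dot /= => v1E w1E.
rewrite v1E w1E sqrtr1 mulr1 divr1.
set c := v1 * w1 + v2 * w2; set k := - v2 * w1 + v1 * w2.
have ck : c ^+ 2 + k ^+ 2 = 1.
  rewrite -[RHS]mulr1 -{1}v1E -w1E /c /k; ring.
have c1 : -1 <= c <= 1.
  by rewrite -ler_norml -(@expr_le1 _ 2)// real_normK ?num_real// -ck lerDl sqr_ge0.
have a0 := acos_ge0 c1.
have := @acosK R c; rewrite in_itv /= => /(_ c1) ca.
have pi0 := @pi_gt0 R.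
(* With [e] the sign of the angle, [e * k = 1], so the squared distance from [w] to [e] times
   [rot90 v] is [2 - 2 * (e * k) = 0]. *)
have key (e : R) : e ^+ 2 = 1 -> c = 0 -> 0 <= e * k -> w1 = - (e * v2) /\ w2 = e * v1.
  move=> e2 c0 ek0.
  have ek : e * k = 1.
    apply/eqP; rewrite -(@eqrXn2 _ 2)// expr1n exprMn e2 mul1r.
    by move: ck; rewrite c0 expr0n /= add0r => ->.
  have : (w1 + e * v2) ^+ 2 + (w2 - e * v1) ^+ 2 = 0.
    rewrite (_ : _ + _ = (w1 * w1 + w2 * w2) + e ^+ 2 * (v1 * v1 + v2 * v2) - 2 * (e * k)).
      by rewrite w1E e2 v1E ek; ring.
    by rewrite /k; ring.
  move/eqP; rewrite paddr_eq0 ?sqr_ge0// !expf_eq0 /= => /andP[/eqP h1 /eqP h2].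
  by split; lra.
case: ifP => k0; split=> h.
- have c0 : c = 0 by rewrite -ca h cos_pihalf.
  by have [||//|] := key 1; rewrite ?expr1n ?mul1r// => -> ->.
- exfalso; lra.
- exfalso; lra.
- have c0 : c = 0 by rewrite -ca (_ : acos c = pi / 2) ?cos_pihalf//; lra.
  have k0' : 0 <= -1 * k by rewrite mulN1r oppr_ge0 ltW// ltNge k0.
  by have [||//|] := key (-1); rewrite ?sqrrN ?expr1n// !mulN1r opprK => -> ->; rewrite -[v2 in LHS]opprK.
Qed.

End PlaneCurves.

(** * Supporting half-planes and the Neumann condition *)

Section Support.
Context {R : realType}.

(* Excludes that a support curve lies on the outer side of one of its tangents. *)
Lemma unbounded_ray_component (A : set (plane R)) (v n : plane R) (h : R) :
  n <> 0 -> (forall k, 0 < k -> A (v + k *: n)) -> 0 < h ->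
  ~ bounded_set (connected_component A (v + h *: n)).
Proof.
move=> n0 An h0 bA.
pose ray := [set v + k *: n | k in `]0, +oo[%classic].
have ray_conn : connected ray.
  apply: connected_continuous_connected.
    exact/connected_intervalP/interval_is_interval.
  apply: continuous_subspaceT => k.
  by apply: cvgD; [exact: cvg_cst|apply: cvgZr_tmp].
have rayA : ray `<=` connected_component A (v + h *: n).
  apply: connected_component_max => //.
    by exists h => //=; rewrite in_itv /= h0.
  by move=> w [k]; rewrite /= in_itv /= andbT => k0 <-; exact: An.
have [M [_ hM]] := bA.
have nn0 : 0 < `|n| by rewrite normr_gt0; exact/eqP.
pose M' := `|M| + 1.
(* With this [k] the vector [k *: n] has norm [M' + |v| + 1], so the ray point has norm greater than
   [M']. *)
pose k := (M' + `|v| + 1) / `|n|.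
have k0 : 0 < k by rewrite divr_gt0// /M' -addrA -addrA ltr_wpDl// addr_gt0// ltr_wpDl.
have := hM M' _ (v + k *: n) (rayA _ _).
rewrite /M' (le_lt_trans (ler_norm M)) ?ltrDl// => /(_ isT).
have rk : ray (v + k *: n) by exists k => //=; rewrite in_itv /= k0.
move=> /(_ rk) /=; apply/negP; rewrite -ltNge -/M'.
have := ler_normB (v + k *: n) v.
rewrite addrC addKr normrZ (gtr0_norm k0) /k divfK ?gt_eqF// => H.
by rewrite -(ltrD2r `|v|) (lt_le_trans _ H)// ltrDl.
Qed.

Variables (sa sb : R) (sf : R -> plane R).
Hypothesis hS : support_curve sa sb sf.
Let I : set R := `[sa, sb].

Lemma supp_tangent_unit s : I s -> dot (tangent I sf s) (tangent I sf s) = 1.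
Proof.
move=> Is; have h := supp_arclength hS Is.
have e1 : enorm (tangent I sf s) = 1.
  by rewrite /tangent /arc_derive /speed h invr1 scale1r h.
have := e1; rewrite /enorm => h2.
rewrite -[LHS]sqr_sqrtr ?h2 ?expr1n//.
by rewrite /dot addr_ge0// -expr2 sqr_ge0.
Qed.

(** Convexity leaves the side open; orientation decides it. Were the image on the other side, the
    open normal ray would miss it and lie in an unbounded component, whereas points of the ray near
    the curve belong to the bounded inside. *)
Lemma support_halfplane s u : I s -> I u ->
  0 <= dot (sf u - sf s) (normal I sf s).
Proof.
move=> Is Iu; have [/(_ _ Iu)//|H] := supp_convex hS Is.
exfalso; set n := normal I sf s in H *.
have nn : dot n n = 1.
  rewrite -(supp_tangent_unit Is) /n /normal /rot90 /dot /=; ring.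
have n0 : n <> 0 by move=> n0; move: nn; rewrite n0 /dot /= mulr0 addr0 => /eqP; rewrite eq_sym oner_eq0.
have [h [h0 [_ hb]]] : exists h, 0 < h /\ supp_inside sa sb sf (sf s + h *: n).
  have hh : \forall h \near (0:R)^'+, supp_inside sa sb sf (sf s + h *: n) /\ 0 < h.
    near=> h; split; last by near: h; exact: nbhs_right_gt.
    by near: h; exact: (supp_oriented hS Is).
  by have [h [h1 h2]] := filter_ex hh; exists h.
apply: unbounded_ray_component hb => // k k0 [u' Iu' hu'].
have := H u' Iu'; rewrite hu' addrC addKr.
rewrite (_ : dot _ n = k * dot n n); last by rewrite /dot /=; rewrite /GRing.scale /=; ring.
by rewrite nn mulr1 leNgt k0.
Unshelve. all: end_near. Qed.

(** [supp_tangent] picks a parameter over [x]; the half-plane at that very parameter is the one used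
    below. *)
Lemma supp_tangentP x : supp_image sa sb sf x ->
  exists s, [/\ I s, sf s = x & supp_tangent sa sb sf x = tangent I sf s].
Proof.
move=> [s Is sx]; rewrite /supp_tangent -/I; case: xgetP => [s' _ [Is' sx']|/(_ s)].
  by exists s'.
by case.
Qed.

(** Perpendicularity makes the inner normal of the support curve equal to [- tau] at [a] and to
    [tau] at [b], so its half-planes become inequalities on the tangents of [f]. If the endpoints
    coincide, so do the support tangents, whence opposite tangents of [f]. *)
Lemma neumann_halfplanes (a b : R) (f : R -> plane R) :
  dot (tangent `[a, b] f a) (tangent `[a, b] f a) = 1 ->
  dot (tangent `[a, b] f b) (tangent `[a, b] f b) = 1 ->
  neumann_boundary sa sb sf a b f ->
  [/\ forall z, supp_image sa sb sf z -> dot (z - f a) (tangent `[a, b] f a) <= 0,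
      forall z, supp_image sa sb sf z -> 0 <= dot (z - f b) (tangent `[a, b] f b) &
      f a = f b -> tangent `[a, b] f b = - tangent `[a, b] f a].
Proof.
set ta := tangent _ f a; set tb := tangent _ f b => ta1 tb1 [fa fb oa ob].
have [s [Is sx tx]] := supp_tangentP fa.
have [u [Iu uy ty]] := supp_tangentP fb.
have wa : tangent I sf s = rot90 ta.
  by apply: (oangle_perp ta1 (supp_tangent_unit Is)).1; rewrite -tx.
have wb : tangent I sf u = - rot90 tb.
  by apply: (oangle_perp tb1 (supp_tangent_unit Iu)).2; rewrite -ty.
split.
- move=> z [v Iv <-]; have := support_halfplane Is Iv.
  rewrite /normal wa sx -oppr_le0; congr (_ <= _).
  by rewrite /dot /rot90 /=; ring.
- move=> z [v Iv <-]; have := support_halfplane Iu Iv.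
  rewrite /normal wb uy; congr (_ <= _).
  by rewrite /dot /rot90 /=; ring.
- move=> fab; have := congr1 (supp_tangent sa sb sf) fab; rewrite tx ty wa wb.
  clearbody ta tb; clear; case: ta => a1 a2; case: tb => b1 b2 h.
  have h1 : - a2 = - - b2 := congr1 fst h.
  have h2 : a1 = - b1 := congr1 snd h.
  by change ((b1, b2) = (- a1, - a2)); rewrite h1 h2 !opprK.
Qed.

End Support.

(* The arc is written in the frame given by its initial tangent: [(X, Y)] has speed
   [s] and tangent angle [Th]. *)
Section ConvexArc.
Context {R : realType}.
Variables (a b : R) (X Y Th k s : R -> R).
Let I : set R := `[a, b].
Hypothesis dX : forall p, a <= p <= b -> deriv_at I X p (s p * cos (Th p)).
Hypothesis dY : forall p, a <= p <= b -> deriv_at I Y p (s p * sin (Th p)).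
Hypothesis dTh : forall p, a <= p <= b -> deriv_at I Th p (k p).
Hypothesis k_ge0 : forall p, a <= p <= b -> 0 <= k p.
Hypothesis s_gt0 : forall p, a <= p <= b -> 0 < s p.

Lemma subset_segment (p q : R) : a <= p -> q <= b -> `[p, q] `<=` I.
Proof.
move=> ap qb u; rewrite /I /= !in_itv /= => /andP[pu uq].
by rewrite (le_trans ap) ?(le_trans uq).
Qed.

Lemma angle_le p q : a <= p -> p <= q -> q <= b -> Th p <= Th q.
Proof.
move=> ap pq qb; apply: (@deriv_at_ge0_le R p q Th k) => // u /andP[pu uq].
  by apply: (deriv_at_sub (subset_segment ap qb)); apply: dTh; rewrite (le_trans ap) ?(le_trans uq).
by apply: k_ge0; rewrite (le_trans ap) ?(le_trans _ qb) ?ltW.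
Qed.

(** Coordinates in the frame rotated by [al]: [h] along the direction [al], [g] along its left
    normal. *)
Let g al p := cos al * Y p - sin al * X p.
Let h al p := cos al * X p + sin al * Y p.

Let dg al p : a <= p <= b -> deriv_at I (g al) p (s p * sin (Th p - al)).
Proof.
move=> pI; have := deriv_atB (deriv_atM (deriv_at_cst I (cos al) p) (dY pI))
  (deriv_atM (deriv_at_cst I (sin al) p) (dX pI)).
by rewrite sinB; congr deriv_at; ring.
Qed.

Let dh al p : a <= p <= b -> deriv_at I (h al) p (s p * cos (Th p - al)).
Proof.
move=> pI; have := deriv_atD (deriv_atM (deriv_at_cst I (cos al) p) (dX pI))
  (deriv_atM (deriv_at_cst I (sin al) p) (dY pI)).
by rewrite cosB; congr deriv_at; ring.
Qed.

(** If the turning is at most [pi], angles measured from the direction at [p] stay in [[0, pi]]. So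
    [g] is monotone with equal end values, hence constant, and the sine vanishes throughout; Rolle's
    theorem for [h] gives a point where the cosine vanishes as well. *)
Lemma loop_turning p q : a <= p -> p < q -> q <= b -> X p = X q -> Y p = Y q ->
  pi < Th q - Th p.
Proof.
move=> ap pq qb EX EY; rewrite ltNge; apply/negP => le_pi.
pose al := Th p.
have inI u : p <= u <= q -> a <= u <= b.
  by move=> /andP[pu uq]; rewrite (le_trans ap) ?(le_trans uq).
have bd u : p <= u <= q -> 0 <= Th u - al <= pi.
  move=> /andP[pu uq]; have h1 := angle_le ap pu (le_trans uq qb).
  have h2 := angle_le (le_trans ap pu) uq qb.
  by rewrite /al; apply/andP; split; lra.
have sin0 u : p <= u <= q -> 0 <= sin (Th u - al).
  by move=> /bd; exact: sin_ge0_pi.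
have dg' u : p <= u <= q -> deriv_at `[p, q] (g al) u (s u * sin (Th u - al)).
  by move=> uI; apply: (deriv_at_sub (subset_segment ap qb)); apply: dg; exact: inI.
have dh' u : p <= u <= q -> deriv_at `[p, q] (h al) u (s u * cos (Th u - al)).
  by move=> uI; apply: (deriv_at_sub (subset_segment ap qb)); apply: dh; exact: inI.
have mono v w : p <= v -> v <= w -> w <= q -> g al v <= g al w.
  move=> pv vw wq.
  have inq u : v <= u <= w -> p <= u <= q.
    by move=> /andP[vu uw]; rewrite (le_trans pv) ?(le_trans uw).
  apply: (deriv_at_ge0_le (df := fun u => s u * sin (Th u - al))) => // u uvw.
    apply: (deriv_at_sub _ (dg' _ (inq _ uvw))) => z; rewrite /= !in_itv; exact: inq.
  have {}uvw : p <= u <= q by apply: inq; case/andP: uvw => *; rewrite !ltW.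
  by rewrite mulr_ge0 ?sin0// ltW// s_gt0// inI.
have gq : g al q = g al p by rewrite /g EX EY.
have gc v : p <= v <= q -> g al v = g al p.
  move=> /andP[pv vq]; apply/eqP; rewrite eq_le.
  by rewrite -{1}gq !mono.
have [u /andP[pu uq]] := deriv_at_MVT pq dh'.
have hq : h al q = h al p by rewrite /h EX EY.
have uI : p <= u <= q by rewrite !ltW.
rewrite hq subrr => /esym/eqP; rewrite !mulf_eq0 subr_eq0 (gt_eqF pq) orbF.
rewrite gt_eqF ?s_gt0 ?inI//= => /eqP cos0.
have : 0 = s u * sin (Th u - al).
  apply: (@deriv_at_unique _ `[p, q] (g al) u).
  - by apply: itv_dnbhs_proper => //; rewrite /= in_itv.
  - apply: (@deriv_at_ext _ _ (fun=> g al p)); last exact: deriv_at_cst.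
    + by move=> v; rewrite /= in_itv => /gc.
    + by rewrite /= in_itv.
  - exact: dg'.
move/esym/eqP; rewrite mulf_eq0 gt_eqF ?s_gt0 ?inI//= => /eqP sin_0.
have := cos2Dsin2 (Th u - al); rewrite cos0 sin_0 expr0n /= addr0 => /eqP.
by rewrite eq_sym oner_eq0.
Qed.

Hypothesis Tha : Th a = 0.
Hypothesis Thb : Th b < pi + pi / 2.
Hypothesis wa : X b - X a <= 0.
Hypothesis wb : (X b - X a) * cos (Th b) + (Y b - Y a) * sin (Th b) <= 0.
Hypothesis closed_ends : X a = X b -> Y a = Y b -> sin (Th b) = 0.

(** Let [w] be the vector from the first to the last point. By [wa] and [wb] it lies in the
    half-planes at both ends. A double point gives [0 <= al < psi < pi / 2] and a third inequality
    on [w]; together they force [w = 0], which [closed_ends] excludes because [sin psi > 0]. *)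
Lemma convex_arc_simple p q : a <= p -> p < q -> q <= b ->
  X p = X q -> Y p = Y q -> False.
Proof.
move=> ap pq qb EX EY.
have turn := loop_turning ap pq qb EX EY.
have pb := le_trans (ltW pq) qb; have aq := le_trans ap (ltW pq).
pose al := Th p; pose psi := Th b - pi.
have al0 : 0 <= al by rewrite /al -Tha; exact: angle_le.
have qb' := angle_le aq qb (lexx b).
have al_psi : al < psi by rewrite /al /psi; lra.
have pi0 := @pi_gt0 R.
have psi_pi : psi < pi / 2 by have := Thb; rewrite /psi; lra.
have mono v w : a <= v -> v <= w -> w <= b ->
    (forall u, v <= u <= w -> sin (Th u - al) <= 0) -> g al w <= g al v.
  move=> av vw wb' hs.
  have inI u : v <= u <= w -> a <= u <= b.
    by move=> /andP[vu uw]; rewrite (le_trans av) ?(le_trans uw).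
  rewrite -lerN2.
  apply: (deriv_at_ge0_le (f := fun u => - g al u) (df := fun u => - (s u * sin (Th u - al)))) => // u uvw.
    apply: deriv_atN; apply: (deriv_at_sub (subset_segment av wb')); apply: dg; exact: inI.
  have {}uvw : v <= u <= w by case/andP: uvw => *; rewrite !ltW.
  by rewrite oppr_ge0 mulr_ge0_le0 ?hs// ltW// s_gt0// inI.
(* Before [p] the angle relative to [al] lies in [[- al, 0]], so [g al] decreases. *)
have g1 : g al p <= g al a.
  apply: mono => // u /andP[au up].
  have := angle_le au up pb; have := angle_le (lexx a) au (le_trans up pb).
  rewrite Tha -/al => h1 h2; rewrite -[Th u - al]opprK sinN oppr_le0.
  by apply: sin_ge0_pi; apply/andP; split; lra.
(* After [q] the relative angle lies between [pi] and [3 pi / 2], by [turn] and the bound on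
   [Th b]. *)
have g2 : g al b <= g al q.
  apply: mono => // u /andP[qu ub].
  have h1 := angle_le aq qu ub; have h2 := angle_le (le_trans aq qu) ub (lexx b).
  rewrite -[Th u - al](subrK pi) sinDpi oppr_le0.
  by apply: sin_ge0_pi; have := Thb; move: al0; rewrite /al => *; apply/andP; split; lra.
(* Across the loop [g al] returns to its value, so the two decreases add up to a sign for the
   determinant of the direction [al] and [w]. *)
have gw : cos al * (Y b - Y a) - sin al * (X b - X a) <= 0.
  have : g al q = g al p by rewrite /g EX EY.
  by move: g1 g2; rewrite /g; lra.
move: wb closed_ends; rewrite -[Th b](subrK pi) -/psi cosDpi sinDpi.
have := wa; move: gw; set w1 := X b - X a; set w2 := Y b - Y a => gw wa' wb' cl.
have spsi : 0 < sin psi by apply: sin_gt0_pi; apply/andP; split; lra.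
have cal : 0 < cos al by apply: cos_gt0_pihalf; apply/andP; split; lra.
have cd : 0 < cos (psi - al) by apply: cos_gt0_pihalf; apply/andP; split; lra.
(* In the identity [cos (psi - al) * w1 = cos al * (w1 * cos psi + w2 * sin psi) - sin psi * (cos al
   * w2 - sin al * w1)] the left side is nonpositive and the right side nonnegative. *)
have w10 : w1 = 0.
  have h1 : 0 <= - (cos (psi - al) * w1).
    by rewrite oppr_ge0 pmulr_rle0.
  have h2 : 0 <= cos al * (w1 * cos psi + w2 * sin psi) by rewrite pmulr_rge0//; lra.
  have h3 : sin psi * (cos al * w2 - sin al * w1) <= 0 by rewrite pmulr_rle0.
  have : cos (psi - al) * w1 = 0 by rewrite cosB; move: h1; rewrite cosB; lra.
  by move/eqP; rewrite mulf_eq0 gt_eqF//= => /eqP.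
have w20 : w2 = 0.
  apply/eqP; rewrite eq_le; apply/andP; split.
    by rewrite -(pmulr_rle0 _ cal); move: gw; rewrite w10 mulr0 subr0.
  by rewrite -(pmulr_lge0 _ spsi); move: wb'; rewrite w10; lra.
have : - sin psi = 0 by apply: cl; apply/eqP; rewrite eq_sym -subr_eq0; apply/eqP.
by lra.
Qed.

End ConvexArc.

(** * From a planar curve to its tangent angle *)

Section CurveFrame.
Context {R : realType}.
Variables (a b : R) (ab : a < b) (f : R -> plane R).
Local Notation I := (`[a, b]%classic : set R).
Local Notation A := (derive_in I f).
Local Notation B := (derive_in I A).
Hypothesis df : forall p, I p -> derivable_in I f p.
Hypothesis ddf : forall p, I p -> derivable_in I A p.
Hypothesis regf : regular I f.
Hypothesis cB1 : {within I, continuous (fun p => (B p).1)}.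
Hypothesis cB2 : {within I, continuous (fun p => (B p).2)}.
Local Notation r p := (speed I f p)^-1.
Local Notation k p := (curvature I f p * speed I f p).

Lemma invspeed_sqr p : I p -> r p ^+ 2 * ((A p).1 ^+ 2 + (A p).2 ^+ 2) = 1.
Proof.
by move=> Ip; rewrite -speed_sqr -exprMn mulVf ?expr1n// gt_eqF//; exact: speed_gt0.
Qed.

Lemma dot_tangent p : I p -> dot (tangent I f p) (tangent I f p) = 1.
Proof.
move=> Ip; rewrite -(invspeed_sqr Ip) /tangent /arc_derive.
by move: (A p) (r p) => [u v] s; rewrite /dot /= /GRing.scale /=; ring.
Qed.

Lemma turning_rateE p : I p ->
  k p = ((A p).1 * (B p).2 - (A p).2 * (B p).1) * r p ^+ 2.
Proof.
move=> Ip; rewrite /= (curvatureE ab)//.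
have s0 : speed I f p != 0 by rewrite gt_eqF//; exact: speed_gt0.
by move: (A p) (B p) => [u1 u2] [v1 v2] /=; field.
Qed.

(** Differentiating [r p *: A p] removes the component of [B] along [A]; the rest is [k p] times the
    normal. *)
Lemma frenet p : I p ->
  deriv_at I (fun z => (tangent I f z).1) p (- k p * (tangent I f p).2) /\
  deriv_at I (fun z => (tangent I f z).2) p (k p * (tangent I f p).1).
Proof.
move=> Ip; have [] := tangent_deriv ddf regf Ip.
rewrite (turning_rateE Ip).
have -> : tangent I f p = r p *: A p by [].
have := invspeed_sqr Ip.
move: (A p) (B p) (r p) => [u1 u2] [v1 v2] s /= s1 h1 h2.
split; [move: h1|move: h2]; congr deriv_at; rewrite /GRing.scale /=.
- rewrite -[s * v1]mul1r -s1; ring.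
- rewrite -[s * v2]mul1r -s1; ring.
Qed.

Lemma speed_continuous : {within I, continuous (speed I f)}.
Proof.
apply/subspace_continuousP => x Ix.
rewrite (_ : speed I f = fun x => (r x)^-1); last by apply/funext => y; rewrite invrK.
apply: cvgV; first by rewrite invr_eq0 gt_eqF//; exact: speed_gt0.
exact: deriv_at_cont (invspeed_deriv ddf regf Ix).
Qed.

Lemma curvature_continuous : {within I, continuous (curvature I f)}.
Proof.
have cA1 : {within I, continuous (fun p => (A p).1)}.
  apply: (deriv_at_within_continuous (df := fun p => (B p).1)) => x Ix.
  exact: (derivable_in_deriv_at (ddf Ix)).1.
have cA2 : {within I, continuous (fun p => (A p).2)}.
  apply: (deriv_at_within_continuous (df := fun p => (B p).2)) => x Ix.
  exact: (derivable_in_deriv_at (ddf Ix)).2.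
have cr : {within I, continuous (fun p => r p)}.
  apply/subspace_continuousP => x Ix; exact: deriv_at_cont (invspeed_deriv ddf regf Ix).
have : {within I, continuous (fun p => ((A p).1 * (B p).2 - (A p).2 * (B p).1) * (r p * (r p * r p)))}.
  exact: (within_continuousM (within_continuousB (within_continuousM cA1 cB2)
    (within_continuousM cA2 cB1)) (within_continuousM cr (within_continuousM cr cr))).
apply: subspace_eq_continuous => x; rewrite inE => Ix.
by rewrite /from_subspace /= (curvatureE ab)//; move: (A x) (B x) (r x) => u v s; ring.
Qed.

Variables (sa sb : R) (sf : R -> plane R).
Hypothesis hS : support_curve sa sb sf.
Hypothesis hN : neumann_boundary sa sb sf a b f.
Hypothesis hk : forall p, I p -> 0 <= curvature I f p.
Hypothesis htot : total_curvature I f < pi + pi / 2.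

(** Reduction to [convex_arc_simple]: the primitive of [k] vanishing at [a] is the tangent angle
    relative to the initial tangent, and its value at [b] is the total curvature. *)
Lemma convex_arc_injective : set_inj I f.
Proof.
have aI : I a by rewrite /= in_itv /= lexx ltW.
have bI : I b by rewrite /= in_itv /= lexx ltW.
have ck : {within I, continuous (fun p => k p)}.
  by apply: within_continuousM; [exact: curvature_continuous|exact: speed_continuous].
have [Th [Tha Thb dTh]] := antiderivative ab ck.
have inI p : a <= p <= b -> I p by rewrite /= in_itv.
pose u := tangent I f a.
have u1 : u.1 * u.1 + u.2 * u.2 = 1 := dot_tangent aI.
(* [(t1, t2)] is the initial tangent [u] rotated by [Th]. *)
pose t1 p := cos (Th p) * u.1 - sin (Th p) * u.2.
pose t2 p := cos (Th p) * u.2 + sin (Th p) * u.1.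
have dcos p : a <= p <= b -> deriv_at I (fun p => cos (Th p)) p (- sin (Th p) * k p).
  by move=> pI; exact: deriv_at_comp (dTh _ pI) (is_derive_cos _).
have dsin p : a <= p <= b -> deriv_at I (fun p => sin (Th p)) p (cos (Th p) * k p).
  by move=> pI; exact: deriv_at_comp (dTh _ pI) (is_derive_sin _).
have tE p : a <= p <= b -> (tangent I f p).1 = t1 p /\ (tangent I f p).2 = t2 p.
  move=> pI.
  (* Both unit fields satisfy the Frenet equations, so their inner product is constant, equal to 1;
     hence they coincide. *)
  have : (tangent I f a).1 * t1 a + (tangent I f a).2 * t2 a =
         (tangent I f p).1 * t1 p + (tangent I f p).2 * t2 p.
    have /andP[ap pb] := pI.
    apply: (@deriv_at_eq0_cst _ a p (fun p => (tangent I f p).1 * t1 p + (tangent I f p).2 * t2 p)) => // q /andP[aq qp].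
    have qI : a <= q <= b by rewrite aq (le_trans qp).
    apply: (deriv_at_sub (subset_segment (lexx a) pb)).
    have [h1 h2] := frenet (inI _ qI).
    have g1 := deriv_atB (deriv_atM (dcos q qI) (deriv_at_cst I u.1 q))
       (deriv_atM (dsin q qI) (deriv_at_cst I u.2 q)).
    have g2 := deriv_atD (deriv_atM (dcos q qI) (deriv_at_cst I u.2 q))
       (deriv_atM (dsin q qI) (deriv_at_cst I u.1 q)).
    apply: (deriv_at_val (deriv_atD (deriv_atM h1 g1) (deriv_atM h2 g2))).
    move: (tangent I f q) (curvature I f q) (speed I f q) => v w z; ring.
  rewrite -/u /t1 /t2 Tha cos0 sin0 !mul1r !mul0r subr0 addr0 u1 -/(t1 p) -/(t2 p) => E.
  have := dot_tangent (inI _ pI); rewrite /dot.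
  move: E; move: (tangent I f p) => [v w] /= E vw1.
  have tt : t1 p ^+ 2 + t2 p ^+ 2 = 1.
    rewrite (_ : _ + _ = (cos (Th p) ^+ 2 + sin (Th p) ^+ 2) * (u.1 * u.1 + u.2 * u.2)).
      by rewrite cos2Dsin2 u1 mulr1.
    by rewrite /t1 /t2; ring.
  have : (v - t1 p) ^+ 2 + (w - t2 p) ^+ 2 = 0.
    rewrite (_ : _ + _ = (v * v + w * w) + (t1 p ^+ 2 + t2 p ^+ 2) - 2 * (v * t1 p + w * t2 p)).
      by rewrite vw1 tt -E; ring.
    by ring.
  move/eqP; rewrite paddr_eq0 ?sqr_ge0// !expf_eq0 /= !subr_eq0.
  by move=> /andP[/eqP -> /eqP ->].
have AE p : a <= p <= b -> (A p).1 = speed I f p * t1 p /\ (A p).2 = speed I f p * t2 p.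
  move=> pI; have [<- <-] := tE _ pI; rewrite /tangent /arc_derive.
  have s0 : speed I f p != 0 by rewrite gt_eqF//; apply: speed_gt0 => //; exact: inI.
  move: (A p) => [v w]; rewrite /= /GRing.scale /=.
  by rewrite !mulrA divff// !mul1r.
(* Coordinates of [f] in the frame formed by [u] and [rot90 u]. *)
pose X p := (f p).1 * u.1 + (f p).2 * u.2.
pose Y p := (f p).2 * u.1 - (f p).1 * u.2.
have df12 p (pI : a <= p <= b) := derivable_in_deriv_at (df (inI p pI)).
have dX p : a <= p <= b -> deriv_at I X p (speed I f p * cos (Th p)).
  move=> pI; have [h1 h2] := df12 p pI; have [A1 A2] := AE p pI.
  apply: (deriv_at_val (deriv_atD (deriv_atM h1 (deriv_at_cst I u.1 p))
    (deriv_atM h2 (deriv_at_cst I u.2 p)))).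
  rewrite A1 A2 /t1 /t2 -[RHS]mulr1 -u1.
  move: (f p) (speed I f p) => w z; ring.
have dY p : a <= p <= b -> deriv_at I Y p (speed I f p * sin (Th p)).
  move=> pI; have [h1 h2] := df12 p pI; have [A1 A2] := AE p pI.
  apply: (deriv_at_val (deriv_atB (deriv_atM h2 (deriv_at_cst I u.1 p))
    (deriv_atM h1 (deriv_at_cst I u.2 p)))).
  rewrite A1 A2 /t1 /t2 -[RHS]mulr1 -u1.
  move: (f p) (speed I f p) => w z; ring.
have [na nb nab] := neumann_halfplanes hS (dot_tangent aI) (dot_tangent bI) hN.
have [fa fb _ _] := hN.
have [tb1 tb2] : (tangent I f b).1 = t1 b /\ (tangent I f b).2 = t2 b.
  by apply: tE; rewrite lexx ltW.
have fE z : (f z).1 = X z * u.1 - Y z * u.2 /\ (f z).2 = X z * u.2 + Y z * u.1.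
  by split; rewrite -[LHS]mulr1 -u1 /X /Y; ring.
have wa : X b - X a <= 0.
  by have := na _ fb; congr (_ <= _); rewrite /X -/u /dot /=; ring.
have wb : (X b - X a) * cos (Th b) + (Y b - Y a) * sin (Th b) <= 0.
  have := nb _ fa; rewrite -oppr_le0; congr (_ <= _).
  by rewrite /dot tb1 tb2 /t1 /t2 /X /Y /=; ring.
have ends : X a = X b -> Y a = Y b -> sin (Th b) = 0.
  move=> Xab Yab; have fab : f a = f b.
    have := fE a; have := fE b; rewrite Xab Yab.
    by case: (f a) (f b) => [x y] [x' y'] /= [-> ->] [-> ->].
  have tab := nab fab.
  have h1 : t1 b = - u.1 by rewrite -tb1 tab.
  have h2 : t2 b = - u.2 by rewrite -tb2 tab.
  (* The sine is the determinant of [u] and the final tangent, here [- u]. *)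
  have -> : sin (Th b) = t2 b * u.1 - t1 b * u.2.
    by rewrite -[LHS]mulr1 -u1 /t1 /t2; ring.
  by rewrite h1 h2; ring.
move=> p q; rewrite !inE => pI qI fpq.
apply/eqP/negPn/negP => pq.
wlog {pq} pq : p q pI qI fpq / p < q.
  by move: pq; rewrite neq_lt => /orP[pq|qp] H; [exact: (H p q)|exact: (H q p)].
move: pI qI; rewrite /= !in_itv /= => /andP[ap _] /andP[_ qb].
apply: (@convex_arc_simple _ a b X Y Th (fun p => k p) (speed I f) dX dY dTh _ _ Tha _ wa wb ends p q) => //.
- by move=> z /inI zI; rewrite mulr_ge0 ?hk// ltW//; exact: speed_gt0.
- by move=> z /inI zI; exact: speed_gt0.
- by rewrite Thb; exact: htot.
- by rewrite /X fpq.
- by rewrite /Y fpq.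
Qed.

End CurveFrame.

(** * Evolution of the curvature *)

Section Schwarz.
Context {R : realType}.

(** The mean value theorem is applied in time to the difference of two slices, then in space to
    [ft]. *)
Lemma double_MVT (I J : set R) (f ft ftp : R -> R -> R) (x0 x1 t0 t1 : R) :
  `[x0, x1] `<=` I -> `[t0, t1] `<=` J -> x0 < x1 -> t0 < t1 ->
  (forall p t, I p -> J t -> deriv_at J (f p) t (ft p t)) ->
  (forall p t, I p -> J t -> deriv_at I (ft ^~ t) p (ftp p t)) ->
  exists p t, [/\ x0 < p < x1, t0 < t < t1 &
    f x1 t1 - f x0 t1 - (f x1 t0 - f x0 t0) = ftp p t * (x1 - x0) * (t1 - t0)].
Proof.
move=> xI tJ x01 t01 dt dp.
have inI p : x0 <= p <= x1 -> I p by move=> h; apply: xI; rewrite /= in_itv.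
have inJ t : t0 <= t <= t1 -> J t by move=> h; apply: tJ; rewrite /= in_itv.
have I0 : I x0 by apply: inI; rewrite lexx ltW.
have I1 : I x1 by apply: inI; rewrite lexx andbT ltW.
have [|t tI E1] := @deriv_at_MVT R t0 t1 (fun t => f x1 t - f x0 t) (fun t => ft x1 t - ft x0 t) t01.
  move=> t tI; apply: (deriv_at_sub tJ).
  by apply: deriv_atB; apply: dt => //; exact: inJ.
have Jt : J t by apply: inJ; case/andP: tI => *; rewrite !ltW.
have [|p pI E2] := @deriv_at_MVT R x0 x1 (ft ^~ t) (ftp ^~ t) x01.
  by move=> p pI; apply: (deriv_at_sub xI); apply: dp => //; exact: inI.
by exists p, t; split=> //; rewrite E1 E2.
Qed.

Definition cont_at (I J : set R) (g : R -> R -> R) (p t : R) : Prop :=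
  (fun z : R * R => g z.1 z.2) @ within (I `*` J) (nbhs (p, t)) --> g p t.

Lemma cont_at_eps I J g p t : cont_at I J g p t -> forall e, 0 < e ->
  exists2 d, 0 < d & forall x s, I x -> J s -> `|p - x| < d -> `|t - s| < d ->
    `|g p t - g x s| < e.
Proof.
move=> /cvgrPdist_lt h e e0; have := h e e0.
rewrite /within /= => -[[U V] /= [[d1 /= d10 h1] [d2 /= d20 h2]] UV].
exists (Num.min d1 d2); first by rewrite lt_min d10.
move=> x s Ix Js; rewrite !lt_min => /andP[px1 px2] /andP[ts1 ts2].
by apply: (UV (x, s)); split=> //=; [exact: h1|exact: h2].
Qed.

(** Both orders of differentiation represent the same second difference over an arbitrarily small
    rectangle at [(p, t)]. Were the two values [e > 0] apart, continuity of each within [e / 2]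
    would give [e < e]. *)
Lemma mixed_derivatives (a b : R) (J : set R) (f fp ft fpt ftp : R -> R -> R) (p t : R) :
  a < b -> nbhs t J -> a <= p <= b ->
  (forall p t, `[a, b]%classic p -> J t -> deriv_at J (f p) t (ft p t)) ->
  (forall p t, `[a, b]%classic p -> J t -> deriv_at `[a, b] (f ^~ t) p (fp p t)) ->
  (forall p t, `[a, b]%classic p -> J t -> deriv_at `[a, b] (ft ^~ t) p (ftp p t)) ->
  (forall p t, `[a, b]%classic p -> J t -> deriv_at J (fp p) t (fpt p t)) ->
  cont_at `[a, b] J ftp p t -> cont_at `[a, b] J fpt p t ->
  fpt p t = ftp p t.
Proof.
move=> ab [e0 /= e0_gt0 hJ] /andP[ap pb] dt dp dtp dpt c1 c2.
apply/eqP; rewrite -subr_eq0 -normr_eq0; apply: contraT => ne0.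
set e := `|_| in ne0.
have e_gt0 : 0 < e by rewrite lt_neqAle eq_sym ne0 normr_ge0.
have e2 : 0 < e / 2 by rewrite divr_gt0.
have [d1 d10 h1] := cont_at_eps c1 e2.
have [d2 d20 h2] := cont_at_eps c2 e2.
pose d := Num.min (Num.min d1 d2) (Num.min e0 (b - a)).
have d0 : 0 < d by rewrite !lt_min d10 d20 e0_gt0 subr_gt0.
have [dd1 dd2 de0 dba] : [/\ d <= d1, d <= d2, d <= e0 & d <= b - a].
  by split; rewrite /d !ge_min lexx ?orbT.
(* The point [p] is the left edge if there is room to its right, and otherwise the right edge, so
   that both ends of the interval are covered. *)
have [x0 [x1 [x01 ax0 x1b px01 xd]]] : exists x0 x1, [/\ x0 < x1, a <= x0, x1 <= b, x0 <= p <= x1 & x1 - x0 < d].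
  have [pd|dp'] := leP (p + d / 2) b.
    by exists p, (p + d / 2); split => //; rewrite ?lexx /=; lra.
  by exists (p - d / 2), p; split => //; rewrite ?lexx ?andbT /=; lra.
have t01 : t < t + d / 2 by rewrite ltrDl divr_gt0.
have xI : `[x0, x1] `<=` `[a, b].
  move=> u; rewrite /= !in_itv /= => /andP[h3 h4].
  by rewrite (le_trans ax0) ?(le_trans _ x1b).
have tJ : `[t, t + d / 2] `<=` J.
  move=> u; rewrite /= in_itv /= => /andP[h3 h4]; apply: hJ => /=.
  by rewrite distrC ger0_norm; lra.
have [p1 [t1 [p1I t1I E1]]] := double_MVT xI tJ x01 t01 dt dtp.
have [t2 [p2 [t2I p2I E2]]] :=
  @double_MVT J `[a, b] (fun t p => f p t) (fun t p => fp p t) (fun t p => fpt p t)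
   _ _ _ _ tJ xI t01 x01 (fun t p jt ip => dp p t ip jt) (fun t p jt ip => dpt p t ip jt).
have E : ftp p1 t1 = fpt p2 t2.
  have k0 : (x1 - x0) * (d / 2) != 0 by rewrite mulf_neq0 ?subr_eq0 ?gt_eqF// divr_gt0.
  apply: (mulIf k0); move: E1 E2; rewrite [t + _]addrC addrK => E1 E2.
  by rewrite mulrA -E1 (mulrC (x1 - x0)) mulrA -E2; ring.
have near_p x : x0 < x < x1 -> `[a, b]%classic x /\ `|p - x| < d.
  move=> /andP[h3 h4]; split; first by apply: xI; rewrite /= in_itv /= !ltW.
  by rewrite ltr_norml; apply/andP; split; lra.
have near_t s : t < s < t + d / 2 -> J s /\ `|t - s| < d.
  move=> /andP[h3 h4]; split; first by apply: tJ; rewrite /= in_itv /= !ltW.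
  by rewrite ltr_norml; apply/andP; split; lra.
have [I1 P1] := near_p _ p1I; have [I2 P2] := near_p _ p2I.
have [J1 T1] := near_t _ t1I; have [J2 T2] := near_t _ t2I.
have H1 := h1 _ _ I1 J1 (lt_le_trans P1 dd1) (lt_le_trans T1 dd1).
have H2 := h2 _ _ I2 J2 (lt_le_trans P2 dd2) (lt_le_trans T2 dd2).
have : e < e.
  have := ler_distD (fpt p2 t2) (fpt p t) (ftp p t).
  by rewrite -/e -{2}E [`|ftp p1 t1 - _|]distrC; lra.
by rewrite ltxx.
Qed.

Lemma jointly_continuous_cont_at I J (c : R -> R -> plane R) p t :
  jointly_continuous I J c -> I p -> J t ->
  cont_at I J (fun p t => (c p t).1) p t /\ cont_at I J (fun p t => (c p t).2) p t.
Proof.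
move=> /subspace_continuousP /(_ (p, t)) h Ip Jt.
by have /plane_cvgP := h (conj Ip Jt).
Qed.

Lemma dspace_deriv_at I J (c : R -> R -> plane R) p t : has_dspace I J c -> I p -> J t ->
  deriv_at I (fun p => (c p t).1) p (dspace I c p t).1 /\
  deriv_at I (fun p => (c p t).2) p (dspace I c p t).2.
Proof. by move=> h Ip Jt; exact: derivable_in_deriv_at (h p t Ip Jt). Qed.

Lemma dtime_deriv_at I J (c : R -> R -> plane R) p t : has_dtime I J c -> I p -> J t ->
  deriv_at J (fun t => (c p t).1) t (dtime J c p t).1 /\
  deriv_at J (fun t => (c p t).2) t (dtime J c p t).2.
Proof. by move=> h Ip Jt; exact: derivable_in_deriv_at (h p t Ip Jt). Qed.

Lemma plane_ext (v w : plane R) : v.1 = w.1 -> v.2 = w.2 -> v = w.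
Proof. by case: v w => [? ?] [? ?] /= -> ->. Qed.

Lemma dtime_dspace (a b : R) (J : set R) (c : R -> R -> plane R) p t :
  a < b -> nbhs t J -> has_dspace `[a, b] J c -> has_dtime `[a, b] J c ->
  has_dtime `[a, b] J (dspace `[a, b] c) -> has_dspace `[a, b] J (dtime J c) ->
  jointly_continuous `[a, b] J (dtime J (dspace `[a, b] c)) ->
  jointly_continuous `[a, b] J (dspace `[a, b] (dtime J c)) ->
  `[a, b]%classic p -> J t ->
  dtime J (dspace `[a, b] c) p t = dspace `[a, b] (dtime J c) p t.
Proof.
move=> ab nJ hp ht hpt htp cpt ctp Ip Jt.
have pI : a <= p <= b by move: Ip; rewrite /= in_itv.
have [c1 c2] := jointly_continuous_cont_at cpt Ip Jt.
have [c3 c4] := jointly_continuous_cont_at ctp Ip Jt.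
apply: plane_ext.
- apply: (mixed_derivatives ab nJ pI _ _ _ _ c3 c1) => q s Iq Js.
  + exact: (dtime_deriv_at ht Iq Js).1.
  + exact: (dspace_deriv_at hp Iq Js).1.
  + exact: (dspace_deriv_at htp Iq Js).1.
  + exact: (dtime_deriv_at hpt Iq Js).1.
- apply: (mixed_derivatives ab nJ pI _ _ _ _ c4 c2) => q s Iq Js.
  + exact: (dtime_deriv_at ht Iq Js).2.
  + exact: (dspace_deriv_at hp Iq Js).2.
  + exact: (dspace_deriv_at htp Iq Js).2.
  + exact: (dtime_deriv_at hpt Iq Js).2.
Qed.

End Schwarz.

(** * Open and half-open time intervals *)

Section TimeSets.
Context {R : realType}.

Lemma time_ioo_ico (T : \bar R) : time_ioo T `<=` time_ico T.
Proof. by move=> t [t0 tT]; split=> //; exact: ltW. Qed.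

Lemma nbhs_time_ioo (T : \bar R) (t : R) : time_ioo T t -> nbhs t (time_ioo T).
Proof.
move=> [t0 tT]; case: T tT => [T|_|//].
- rewrite lte_fin => tT; have /near_in_itvoo : t \in `]0, T[ by rewrite in_itv /= t0.
  by apply: filterS => s; rewrite in_itv /= => /andP[s0 sT]; split; rewrite ?lte_fin.
- have /near_in_itvoy : t \in `]0, +oo[ by rewrite in_itv /= t0.
  by apply: filterS => s; rewrite in_itv /= andbT => s0; split; rewrite ?ltry.
Qed.

(** The flow equation differentiates relative to [[0, T)], smoothness relative to [(0, T)]; at
    positive times both are ordinary derivatives. *)
Lemma dtime_time_ioo (I : set R) (T : \bar R) (c : R -> R -> plane R) p t :
  has_dtime I (time_ioo T) c -> I p -> time_ioo T t ->
  dtime (time_ico T) c p t = dtime (time_ioo T) c p t.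
Proof.
move=> hc Ip Jt; have nJ := nbhs_time_ioo Jt.
have nJ0 : nbhs t (time_ico T) by apply: filterS nJ; exact: time_ioo_ico.
have [h1 h2] := dtime_deriv_at hc Ip Jt.
rewrite /dtime (derive_in_pair (nbhs_dnbhs_proper nJ0) (deriv_at_nbhs _ nJ h1) (deriv_at_nbhs _ nJ h2)).
by rewrite -surjective_pairing.
Qed.

End TimeSets.

(* [A], [B], [C] are the first three space derivatives of [c] and [r = 1 / |A|].
   [E] and [G] are the first two space derivatives of the velocity [V nu], where
   [V = kappa - kbar] has space derivatives [K1] and [K2]. *)
Section FlowAlgebra.
Context {R : realFieldType}.
Variables (A1 A2 B1 B2 C1 C2 r V K1 K2 : R).
Hypothesis rA : r ^+ 2 * (A1 ^+ 2 + A2 ^+ 2) = 1.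
Let X := A1 * B2 - A2 * B1.
Let P := A1 * B1 + A2 * B2.
Let r1 := - r ^+ 3 * P.
Let r2 := - 3 * r ^+ 2 * r1 * P - r ^+ 3 * (B1 ^+ 2 + B2 ^+ 2 + (A1 * C1 + A2 * C2)).
Let E1 := - (K1 * r * A2 + V * r1 * A2 + V * r * B2).
Let E2 := K1 * r * A1 + V * r1 * A1 + V * r * B1.
Let G1 := - (K2 * r * A2 + 2 * (K1 * r1 * A2) + 2 * (K1 * r * B2) + V * r2 * A2
  + 2 * (V * r1 * B2) + V * r * C2).
Let G2 := K2 * r * A1 + 2 * (K1 * r1 * A1) + 2 * (K1 * r * B1) + V * r2 * A1
  + 2 * (V * r1 * B1) + V * r * C1.

(** The left side is the time derivative of [X * r ^+ 3]; the right side is [kappa_ss + kappa^2 V],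
    with [kappa_ss] written out through [d/ds = r d/dp]. *)
Lemma curvature_evolution_algebra :
  (E1 * B2 + A1 * G2 - (E2 * B1 + A2 * G1)) * r ^+ 3
    + X * (3 * r ^+ 2 * (- r ^+ 3 * (A1 * E1 + A2 * E2)))
  = K2 * r ^+ 2 - K1 * (r ^+ 4 * P) + (X * r ^+ 3) ^+ 2 * V.
Proof.
apply/eqP; rewrite -subr_eq0; apply/eqP.
(* The explicit cofactor exhibits the difference of the two sides as a multiple of
   [r^2 |A|^2 - 1]. *)
transitivity ((r ^+ 2 * (A1 ^+ 2 + A2 ^+ 2) - 1) *
  (K2 * r ^+ 2 - 2 * K1 * r ^+ 4 * P
   + V * (3 * r ^+ 6 * P ^+ 2 - r ^+ 4 * (B1 ^+ 2 + B2 ^+ 2 + (A1 * C1 + A2 * C2)))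
   + 2 * V * r ^+ 4 * (B1 ^+ 2 + B2 ^+ 2))).
  by rewrite /E1 /E2 /G1 /G2 /r2 /r1 /X /P; ring.
by rewrite rA subrr mul0r.
Qed.

(** This is [tau_t = V_s nu]. The left sides differentiate [r A], with [A_t = E] and
    [r_t = - r^3 (A1 E1 + A2 E2)]. *)
Lemma tangent_evolution_algebra :
  - r ^+ 3 * (A1 * E1 + A2 * E2) * A1 + r * E1 = - (K1 * r * (r * A2)) /\
  - r ^+ 3 * (A1 * E1 + A2 * E2) * A2 + r * E2 = K1 * r * (r * A1).
Proof.
split; apply/eqP; rewrite -subr_eq0; apply/eqP.
- transitivity ((r ^+ 2 * (A1 ^+ 2 + A2 ^+ 2) - 1) * (V * r ^+ 2 * B2)).
    by rewrite /E1 /E2 /r1 /P; ring.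
  by rewrite rA subrr mul0r.
- transitivity ((r ^+ 2 * (A1 ^+ 2 + A2 ^+ 2) - 1) * (- (V * r ^+ 2 * B1))).
    by rewrite /E1 /E2 /r1 /P; ring.
  by rewrite rA subrr mul0r.
Qed.

End FlowAlgebra.

(** * Evolution equations at positive times *)

Section SmoothFlow.
Context {R : realType}.
Variables (a b : R) (ab : a < b) (T : \bar R) (c : R -> R -> plane R) (kb : R -> R).
Local Notation I := (`[a, b]%classic : set R).
Local Notation J := (time_ioo T).
Hypothesis cC : class_C I J 4 c.
Hypothesis creg : forall t, J t -> regular I (c ^~ t).
Hypothesis cflow : forall p t, I p -> J t ->
  dtime J c p t = (curvature I (c ^~ t) p - kb t) *: normal I (c ^~ t) p.

Local Notation A := (dspace I c).
Local Notation B := (dspace I A).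
Local Notation C := (dspace I B).
Local Notation D := (dtime J c).
Local Notation r p t := ((speed I (c ^~ t) p)^-1).
Local Notation kap p t := (curvature I (c ^~ t) p).

(** Equality of mixed derivatives, used once for [c] and once for [A], moves the time derivative
    onto the velocity. The fourth order of regularity supplies the space derivative of [C]. *)
Lemma flow_regularity :
  [/\ has_dspace I J c, has_dspace I J A, has_dspace I J B & has_dspace I J C] /\
  [/\ has_dtime I J A, has_dtime I J B, has_dspace I J D & has_dspace I J (dspace I D)] /\
  (forall p t, I p -> J t -> dtime J A p t = dspace I D p t /\
    dtime J B p t = dspace I (dspace I D) p t).
Proof.
have [_ [hs ht cA cD]] := cC.
have [_ [hsA htA cB cAt]] := cA.
have [_ [hsD _ cDs _]] := cD.
have [_ [hsB htB cC' cBt]] := cB.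
have [jAt [hsAt _ cAts _]] := cAt.
have [jDs [hsDs _ _ _]] := cDs.
have [_ [hsC _ _ _]] := cC'.
have [jBt _] := cBt; have [jAts _] := cAts.
split; [by split|split; first by split].
have E1 p t : I p -> J t -> dtime J A p t = dspace I D p t.
  by move=> Ip Jt; apply: dtime_dspace => //; exact: nbhs_time_ioo.
move=> p t Ip Jt; split; first exact: E1.
rewrite (dtime_dspace ab (nbhs_time_ioo Jt) hsA htA htB hsAt jBt jAts Ip Jt).
apply: (@derive_in_ext _ _ I (dtime J A ^~ t) (dspace I D ^~ t) p _ Ip) => q Iq; exact: E1.
Qed.

Local Notation X p t := ((A p t).1 * (B p t).2 - (A p t).2 * (B p t).1).
Local Notation P p t := ((A p t).1 * (B p t).1 + (A p t).2 * (B p t).2).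
Local Notation r1 p t := (- r p t ^+ 3 * P p t).

(** Space derivative of [X * r ^+ 3]; the determinant of [B] with itself drops out of the derivative
    of [X]. Kept explicit because it is differentiated again. *)
Definition curvature_dp p t :=
  ((A p t).1 * (C p t).2 - (A p t).2 * (C p t).1) * r p t ^+ 3
  + X p t * (3 * r p t ^+ 2 * r1 p t).
Local Notation K1 := curvature_dp.

Ltac atomize_flow := cbv beta; repeat match goal with
  | |- context [curvature_dp ?p ?t] => generalize (curvature_dp p t); intro
  | |- context [curvature ?I ?f ?p] => generalize (curvature I f p); intro
  | |- context [speed ?I ?f ?p] => generalize (speed I f p); intro
  | |- context [dspace ?I ?c ?p ?t] => generalize (dspace I c p t); intro
  end.
Ltac flow_ring := atomize_flow; simpl; ring.

Lemma flow_curvatureE p t : I p -> J t -> kap p t = X p t * r p t ^+ 3.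
Proof.
move=> Ip Jt; have [[_ h _ _] _] := flow_regularity.
exact: (curvatureE ab (fun q Iq => h q t Iq Jt) (creg Jt) Ip).
Qed.

Section FixedTime.
Variables (t : R) (Jt : J t).

Let dA p : I p -> deriv_at I (fun p => (A p t).1) p (B p t).1 /\
  deriv_at I (fun p => (A p t).2) p (B p t).2.
Proof. by move=> Ip; have [[_ h _ _] _] := flow_regularity; exact: dspace_deriv_at h Ip Jt. Qed.

Let dB p : I p -> deriv_at I (fun p => (B p t).1) p (C p t).1 /\
  deriv_at I (fun p => (B p t).2) p (C p t).2.
Proof. by move=> Ip; have [[_ _ h _] _] := flow_regularity; exact: dspace_deriv_at h Ip Jt. Qed.

Let dC p : I p -> deriv_at I (fun p => (C p t).1) p (dspace I C p t).1 /\
  deriv_at I (fun p => (C p t).2) p (dspace I C p t).2.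
Proof. by move=> Ip; have [[_ _ _ h] _] := flow_regularity; exact: dspace_deriv_at h Ip Jt. Qed.

Let derB p : I p -> derivable_in I (A ^~ t) p.
Proof. by move=> Ip; have [[_ h _ _] _] := flow_regularity; exact: h. Qed.

Let dr p : I p -> deriv_at I (fun p => r p t) p (r1 p t).
Proof. by move=> Ip; exact: (invspeed_deriv derB (creg Jt) Ip). Qed.

Let dX p : I p -> deriv_at I (fun p => X p t) p
  ((A p t).1 * (C p t).2 - (A p t).2 * (C p t).1).
Proof.
move=> Ip; have [a1 a2] := dA Ip; have [b1 b2] := dB Ip.
by apply: (deriv_at_val (deriv_atB (deriv_atM a1 b2) (deriv_atM a2 b1)));
  flow_ring.
Qed.

Lemma curvature_dp_deriv p : I p -> deriv_at I (fun p => kap p t) p (K1 p t).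
Proof.
move=> Ip; apply: (@deriv_at_ext _ _ (fun p => X p t * r p t ^+ 3)).
- by move=> q Iq; rewrite (flow_curvatureE Iq Jt).
- by [].
- exact: (deriv_atM (dX Ip) (deriv_atX (n := 3) (dr Ip))).
Qed.

Let dP p : I p -> deriv_at I (fun p => P p t) p
  ((B p t).1 ^+ 2 + (B p t).2 ^+ 2 + ((A p t).1 * (C p t).1 + (A p t).2 * (C p t).2)).
Proof.
move=> Ip; have [a1 a2] := dA Ip; have [b1 b2] := dB Ip.
by apply: (deriv_at_val (deriv_atD (deriv_atM a1 b1) (deriv_atM a2 b2)));
  flow_ring.
Qed.

Let dr1 p : I p -> deriv_at I (fun p => r1 p t) p
  (- 3 * r p t ^+ 2 * r1 p t * P p t - r p t ^+ 3 * ((B p t).1 ^+ 2 + (B p t).2 ^+ 2 +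
    ((A p t).1 * (C p t).1 + (A p t).2 * (C p t).2))).
Proof.
move=> Ip.
by apply: (deriv_at_val (deriv_atM (deriv_atN (deriv_atX (n := 3) (dr Ip))) (dP Ip)));
  flow_ring.
Qed.

(** Existence suffices: the second derivative enters the evolution equation as an unexpanded
    symbol. *)
Lemma curvature_dpp p : I p -> exists K2, deriv_at I (K1 ^~ t) p K2.
Proof.
move=> Ip; have [a1 a2] := dA Ip; have [c1 c2] := dC Ip.
have h1 := deriv_atM (deriv_atB (deriv_atM a1 c2) (deriv_atM a2 c1)) (deriv_atX (n := 3) (dr Ip)).
have h2 := deriv_atM (deriv_atM (deriv_at_cst I 3 p) (deriv_atX (n := 2) (dr Ip))) (dr1 Ip).
by eexists; exact: deriv_atD h1 (deriv_atM (dX Ip) h2).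
Qed.

Lemma flow_velocity p : I p ->
  (D p t).1 = - ((kap p t - kb t) * (r p t * (A p t).2)) /\
  (D p t).2 = (kap p t - kb t) * (r p t * (A p t).1).
Proof.
move=> Ip; rewrite cflow//.
have -> : normal I (c ^~ t) p = rot90 (r p t *: A p t) by [].
move: (A p t) (r p t) (kap p t - kb t) => [u v] s w; rewrite /rot90 /=.
by rewrite /GRing.scale /=; split; ring.
Qed.

Local Notation E1 p := (- (K1 p t * r p t * (A p t).2 + (kap p t - kb t) * r1 p t * (A p t).2
  + (kap p t - kb t) * r p t * (B p t).2)).
Local Notation E2 p := (K1 p t * r p t * (A p t).1 + (kap p t - kb t) * r1 p t * (A p t).1
  + (kap p t - kb t) * r p t * (B p t).1).

Lemma flow_velocity_dp p : I p -> (dspace I D p t).1 = E1 p /\ (dspace I D p t).2 = E2 p.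
Proof.
move=> Ip; have [a1 a2] := dA Ip; have PF := itv_dnbhs_proper ab Ip.
have [_ [[_ _ hD _] _]] := flow_regularity.
have [d1 d2] := dspace_deriv_at hD Ip Jt.
have dV := deriv_atB (curvature_dp_deriv Ip) (deriv_at_cst I (kb t) p).
split; apply: (deriv_at_unique PF).
- exact: d1.
- apply: (@deriv_at_ext _ _ (fun p => - ((kap p t - kb t) * (r p t * (A p t).2)))).
  + by move=> q Iq; have [] := flow_velocity Iq.
  + by [].
  + by apply: (deriv_at_val (deriv_atN (deriv_atM dV (deriv_atM (dr Ip) a2))));
  flow_ring.
- exact: d2.
- apply: (@deriv_at_ext _ _ (fun p => ((kap p t - kb t) * (r p t * (A p t).1)))).
  + by move=> q Iq; have [] := flow_velocity Iq.
  + by [].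
  + by apply: (deriv_at_val (deriv_atM dV (deriv_atM (dr Ip) a1)));
  flow_ring.
Qed.

Local Notation r2 p := (- 3 * r p t ^+ 2 * r1 p t * P p t - r p t ^+ 3 *
  ((B p t).1 ^+ 2 + (B p t).2 ^+ 2 + ((A p t).1 * (C p t).1 + (A p t).2 * (C p t).2))).
Local Notation V p := (kap p t - kb t).

Lemma flow_velocity_dpp p K2 : I p -> deriv_at I (K1 ^~ t) p K2 ->
  (dspace I (dspace I D) p t).1 =
    - (K2 * r p t * (A p t).2 + 2 * (K1 p t * r1 p t * (A p t).2)
       + 2 * (K1 p t * r p t * (B p t).2) + V p * r2 p * (A p t).2
       + 2 * (V p * r1 p t * (B p t).2) + V p * r p t * (C p t).2) /\
  (dspace I (dspace I D) p t).2 =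
    K2 * r p t * (A p t).1 + 2 * (K1 p t * r1 p t * (A p t).1)
       + 2 * (K1 p t * r p t * (B p t).1) + V p * r2 p * (A p t).1
       + 2 * (V p * r1 p t * (B p t).1) + V p * r p t * (C p t).1.
Proof.
move=> Ip dK1; have [a1 a2] := dA Ip; have [b1 b2] := dB Ip.
have PF := itv_dnbhs_proper ab Ip.
have [_ [[_ _ _ hDE] _]] := flow_regularity.
have [d1 d2] := dspace_deriv_at hDE Ip Jt.
have dV := deriv_atB (curvature_dp_deriv Ip) (deriv_at_cst I (kb t) p).
have dr_ := dr Ip; have dr1_ := dr1 Ip.
split; apply: (deriv_at_unique PF).
- exact: d1.
- apply: (@deriv_at_ext _ _ (fun p => E1 p)).
  + by move=> q Iq; have [] := flow_velocity_dp Iq.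
  + by [].
  + apply: (deriv_at_val (deriv_atN (deriv_atD (deriv_atD (deriv_atM (deriv_atM dK1 dr_) a2)
      (deriv_atM (deriv_atM dV dr1_) a2)) (deriv_atM (deriv_atM dV dr_) b2)))).
    flow_ring.
- exact: d2.
- apply: (@deriv_at_ext _ _ (fun p => E2 p)).
  + by move=> q Iq; have [] := flow_velocity_dp Iq.
  + by [].
  + apply: (deriv_at_val (deriv_atD (deriv_atD (deriv_atM (deriv_atM dK1 dr_) a1)
      (deriv_atM (deriv_atM dV dr1_) a1)) (deriv_atM (deriv_atM dV dr_) b1))).
    flow_ring.
Qed.

Lemma invspeed_sqr_flow p : I p -> r p t ^+ 2 * ((A p t).1 ^+ 2 + (A p t).2 ^+ 2) = 1.
Proof. by move=> Ip; exact: (invspeed_sqr (creg Jt) Ip). Qed.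

Let dtA p : I p -> deriv_at J (fun t => (A p t).1) t (E1 p) /\
  deriv_at J (fun t => (A p t).2) t (E2 p).
Proof.
move=> Ip; have [_ [[h _ _ _] /(_ p t Ip Jt)[AD _]]] := flow_regularity.
have [h1 h2] := dtime_deriv_at h Ip Jt.
have [e1 e2] := flow_velocity_dp Ip.
split; first exact: deriv_at_val h1 (etrans (congr1 fst AD) e1).
exact: deriv_at_val h2 (etrans (congr1 snd AD) e2).
Qed.

Let dtr p : I p -> deriv_at J (fun t => r p t) t
  (- r p t ^+ 3 * ((A p t).1 * E1 p + (A p t).2 * E2 p)).
Proof.
move=> Ip; have [h1 h2] := dtA Ip.
exact: (@deriv_at_invenorm _ J (fun t => A p t) t _ _ (creg Jt Ip) h1 h2).
Qed.

(** In the time derivative of [X * r ^+ 3], those of [A] and [B] are replaced by the first two space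
    derivatives of the velocity; the result is [kappa_ss + kappa^2 (kappa - kb)]. *)
Lemma curvature_evolution p : I p -> exists K2,
  deriv_at I (K1 ^~ t) p K2 /\
  deriv_at J (fun t => kap p t) t
    (K2 * r p t ^+ 2 - K1 p t * (r p t ^+ 4 * P p t) + kap p t ^+ 2 * (kap p t - kb t)).
Proof.
move=> Ip; have [K2 dK1] := curvature_dpp Ip; exists K2; split; first exact: dK1.
have [_ [[_ h _ _] /(_ p t Ip Jt)[_ BD]]] := flow_regularity.
have [b1' b2'] := dtime_deriv_at h Ip Jt; have [a1 a2] := dtA Ip.
have [G1 G2] := flow_velocity_dpp Ip dK1.
have b1 := deriv_at_val b1' (etrans (congr1 fst BD) G1).
have b2 := deriv_at_val b2' (etrans (congr1 snd BD) G2).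
apply: (@deriv_at_ext _ _ (fun t => X p t * r p t ^+ 3)).
- by move=> s Js; rewrite (flow_curvatureE Ip Js).
- exact: Jt.
- apply: (deriv_at_val (deriv_atM (deriv_atB (deriv_atM a1 b2) (deriv_atM a2 b1))
    (deriv_atX (n := 3) (dtr Ip)))).
  transitivity (K2 * r p t ^+ 2 - K1 p t * (r p t ^+ 4 * P p t) + (X p t * r p t ^+ 3) ^+ 2 * V p);
    last by rewrite (flow_curvatureE Ip Jt).
  rewrite -(curvature_evolution_algebra (B p t).1 (B p t).2 (C p t).1 (C p t).2 (V p) (K1 p t) K2 (invspeed_sqr_flow Ip)).
  flow_ring.
Qed.

Lemma tangent_evolution p : I p ->
  deriv_at J (fun t => (tangent I (c ^~ t) p).1) t (- (K1 p t * r p t * (r p t * (A p t).2))) /\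
  deriv_at J (fun t => (tangent I (c ^~ t) p).2) t (K1 p t * r p t * (r p t * (A p t).1)).
Proof.
move=> Ip; have [a1 a2] := dtA Ip.
have [e1 e2] := tangent_evolution_algebra (B p t).1 (B p t).2 (V p) (K1 p t) (invspeed_sqr_flow Ip).
split; first exact: deriv_at_val (deriv_atM (dtr Ip) a1) e1.
exact: deriv_at_val (deriv_atM (dtr Ip) a2) e2.
Qed.

End FixedTime.

End SmoothFlow.

(** * The maximum principle *)

Section MaxPrinciple.
Context {R : realType}.
Variables (a b t1 M : R) (ab : a < b) (t1_ge0 : 0 <= t1) (M0 : 0 <= M).
Variables (u K1 alpha beta : R -> R -> R) (kb : R -> R).
Local Notation I := (`[a, b]%classic : set R).
Hypothesis uc : {within I `*` `[0, t1]%classic,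
  continuous (fun z : R * R => u z.1 z.2)}.
Hypothesis u0 : forall p, a <= p <= b -> 0 <= u p 0.
Hypothesis bounds : forall p t, a <= p <= b -> 0 < t <= t1 ->
  [/\ 0 <= alpha p t <= M, `|beta p t| <= M, `|u p t| <= M & kb t <= M].
Hypothesis du : forall p t, a <= p <= b -> 0 < t <= t1 -> deriv_at I (u ^~ t) p (K1 p t).
Hypothesis pde : forall p t, a <= p <= b -> 0 < t <= t1 -> exists K2,
  deriv_at I (K1 ^~ t) p K2 /\
  deriv_at `]0, t1] (u p) t
    (K2 * alpha p t - K1 p t * beta p t + u p t ^+ 2 * (u p t - kb t)).
Hypothesis bc_left : forall t, 0 < t <= t1 ->
  (forall q, a < q < b -> u a t < u q t) -> K1 a t <= 0.
Hypothesis bc_right : forall t, 0 < t <= t1 ->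
  (forall q, a < q < b -> u b t < u q t) -> 0 <= K1 b t.

(** One summand per term of the equation at an interior minimum: [2 M] for diffusion, [2 (b - a) M]
    for transport, [2 M^2] for reaction, and [1] for strictness. *)
Let lam := 2 * M + 2 * (b - a) * M + 2 * M ^+ 2 + 1.
Let m := (a + b) / 2.
Let g (p : R) := 1 + (p - m) ^+ 2.

(** The boundary hypotheses speak only of a boundary value strictly below all interior values of its
    time slice; the weight [g], largest at the ends, brings a touching point on the boundary into
    this situation. *)
Lemma neumann_max_principle p1 : a <= p1 <= b -> 0 <= u p1 t1.
Proof.
move=> p1I; rewrite leNgt; apply/negP => u1.
have g1 p : 1 <= g p by rewrite lerDl sqr_ge0.
have g0 p : 0 < g p by apply: lt_le_trans (g1 p).
pose w (z : R * R) := u z.1 z.2 * (expR (- lam * z.2) / g z.1).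
have wc : {within I `*` `[0, t1]%classic, continuous w}.
  move: uc => /subspace_continuousP uc'; apply/subspace_continuousP => z Dz.
  apply: cvgM; first exact: uc'.
  apply: cvg_within_filter.
  have c1 : {for z, continuous (fun z : R * R => z.1)} by exact: cvg_fst.
  have c2 : {for z, continuous (fun z : R * R => z.2)} by exact: cvg_snd.
  apply: cvgM.
    apply: (@continuous_comp _ _ _ (fun z : R * R => - lam * z.2) expR); last exact: continuous_expR.
    by apply: cvgM => //; exact: cvg_cst.
  apply: cvgV; first by rewrite gt_eqF.
  apply: cvgD; first exact: cvg_cst.
  by rewrite expr2; under eq_fun do rewrite expr2; apply: cvgM; (apply: cvgB; [exact: c1|exact: cvg_cst]).
have [||[p0 t0] /=] := @compact_EVT_min _ R w (I `*` `[0, t1]%classic) _ _ wc.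
- by exists (p1, t1); split; rewrite /= in_itv //= t1_ge0 lexx.
- by apply: compact_setX; exact: segment_compact.
rewrite inE /= => -[]; rewrite /= !in_itv /= => p0I t0I wmin.
have {}wmin p t : a <= p <= b -> 0 <= t <= t1 -> w (p0, t0) <= w (p, t).
  by move=> pI tI; apply: wmin; rewrite inE; split; rewrite /= in_itv.
have t1I : 0 <= t1 <= t1 by rewrite t1_ge0 lexx.
have w0 : w (p0, t0) < 0.
  apply: le_lt_trans (wmin _ _ p1I t1I) _.
  by rewrite /w /= pmulr_llt0// divr_gt0// expR_gt0.
pose eps := - w (p0, t0).
have eps0 : 0 < eps by rewrite oppr_gt0.
(* With [- eps] the minimum of [w], the barrier [- eps * expR (lam * t) * g p] lies below [u] and
   touches it at [(p0, t0)]. *)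
have uge p t : a <= p <= b -> 0 <= t <= t1 -> 0 <= u p t + eps * expR (lam * t) * g p.
  move=> pI tI; have := wmin p t pI tI; rewrite -subr_ge0 -/eps.
  have x0 : 0 < expR (lam * t) * g p by rewrite mulr_gt0// expR_gt0.
  rewrite -(pmulr_lge0 _ x0); congr (_ <= _).
  rewrite /eps /w /= ![- lam * _]mulNr !expRN; field.
  by rewrite !gt_eqF ?expR_gt0.
have ueq : u p0 t0 + eps * expR (lam * t0) * g p0 = 0.
  rewrite /eps /w /= [- lam * _]mulNr expRN; field.
  by rewrite !gt_eqF ?expR_gt0.
(* At time 0 the data are nonnegative while the barrier is negative. *)
have t0_gt0 : 0 < t0.
  have /andP[t00 _] := t0I; rewrite lt_neqAle t00 andbT; apply/eqP => t0E.
  move: ueq; rewrite -t0E => /eqP; rewrite gt_eqF// ltr_wpDl ?u0// !mulr_gt0//.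
  exact: expR_gt0.
have t0J : 0 < t0 <= t1 by rewrite t0_gt0; case/andP: t0I.
pose E := eps * expR (lam * t0).
have E0 : 0 < E by rewrite mulr_gt0// expR_gt0.
have dg p : deriv_at I g p (2 * (p - m)).
  have h := deriv_atB (deriv_at_id I p) (deriv_at_cst I m p).
  apply: (deriv_at_val (deriv_atD (deriv_at_cst I 1 p) (deriv_atM h h))).
  by rewrite /=; ring.
pose v p := u p t0 + E * g p.
have dv p : a <= p <= b -> deriv_at I v p (K1 p t0 + E * (2 * (p - m))).
  move=> pI; apply: (deriv_at_val (deriv_atD (du pI t0J) (deriv_atM (deriv_at_cst I E p) (dg p)))).
  ring.
have v_ge0 p : a <= p <= b -> 0 <= v p by move=> pI; exact: uge.
have v0 : v p0 = 0 by exact: ueq.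
have vmin p : a <= p <= b -> v p0 <= v p by move=> pI; rewrite v0 v_ge0.
have aI : a <= a <= b by rewrite lexx ltW.
have bI : a <= b <= b by rewrite lexx ltW.
have glt q : a < q < b -> g q < g a /\ g q < g b.
  move=> /andP[aq qb]; rewrite /g /m; split; rewrite ltrD2l -subr_gt0.
    rewrite (_ : _ - _ = (q - a) * (b - q)); first by rewrite mulr_gt0// subr_gt0.
    by field.
  rewrite (_ : _ - _ = (q - a) * (b - q)); first by rewrite mulr_gt0// subr_gt0.
  by field.
have qI q : a < q < b -> a <= q <= b by move=> /andP[*]; rewrite !ltW.
have uE p : u p t0 = v p - E * g p by rewrite /v addrK.
have PF p : a <= p <= b -> ProperFilter (within I p^').
  by move=> pI; apply: itv_dnbhs_proper => //; rewrite /= in_itv.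
(* From [g q < g a] and [v a = 0 <= v q] the value [u a] lies below all interior ones, so
   [K1 a <= 0]. A minimum of [v] at the left end requires [K1 a >= E * (b - a) > 0]. *)
have p0a : p0 != a.
  apply/eqP => p0E; have : 0 <= K1 a t0 + E * (2 * (a - m)).
    apply: (deriv_at_min_right (PF _ aI) _ (dv _ aI)) => q; rewrite /= in_itv => qI'.
    by split; [case/andP: qI'|rewrite -p0E; exact: vmin].
  have K1a : K1 a t0 <= 0.
    apply: bc_left => // q qab; have [gqa _] := glt q qab.
    have va : v a = 0 by rewrite -p0E.
    have := v_ge0 q (qI q qab); rewrite !uE va.
    by rewrite -(ltr_pM2l E0) in gqa; lra.
  rewrite leNgt; apply/negP; rewrite negbK.
  have : 0 < E * (b - a) by rewrite mulr_gt0// subr_gt0.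
  rewrite (_ : 2 * (a - m) = - (b - a)); first by lra.
  by rewrite /m; field.
have p0b : p0 != b.
  apply/eqP => p0E; have : K1 b t0 + E * (2 * (b - m)) <= 0.
    apply: (deriv_at_min_left (PF _ bI) _ (dv _ bI)) => q; rewrite /= in_itv => qI'.
    by split; [case/andP: qI'|rewrite -p0E; exact: vmin].
  have K1b : 0 <= K1 b t0.
    apply: bc_right => // q qab; have [_ gqb] := glt q qab.
    have vb : v b = 0 by rewrite -p0E.
    have := v_ge0 q (qI q qab); rewrite !uE vb.
    by rewrite -(ltr_pM2l E0) in gqb; lra.
  rewrite leNgt; apply/negP; rewrite negbK.
  have : 0 < E * (b - a) by rewrite mulr_gt0// subr_gt0.
  rewrite (_ : 2 * (b - m) = (b - a)); first by lra.
  by rewrite /m; field.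
have {}p0I : a < p0 < b.
  by case/andP: p0I => ap pb; rewrite !lt_neqAle eq_sym p0a ap p0b pb.
have [K2 [dK1 ut]] := pde (qI _ p0I) t0J.
have dv2 : deriv_at I (fun p => K1 p t0 + E * (2 * (p - m))) p0 (K2 + 2 * E).
  have h := deriv_atM (deriv_at_cst I 2 p0) (deriv_atB (deriv_at_id I p0) (deriv_at_cst I m p0)).
  apply: (deriv_at_val (deriv_atD dK1 (deriv_atM (deriv_at_cst I E p0) h))).
  by rewrite /=; ring.
have [K1E K2E] := second_deriv_at_min p0I dv dv2 vmin.
(* The minimum in time is used from the past only, which covers [t0 = t1]. *)
have {}ut : K2 * alpha p0 t0 - K1 p0 t0 * beta p0 t0 + u p0 t0 ^+ 2 * (u p0 t0 - kb t0)
    + lam * E * g p0 <= 0.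
  have th : t0 / 2 < t0 by lra.
  have th0 : 0 < t0 / 2 by lra.
  apply: (@deriv_at_min_left _ `[t0 / 2, t0] (fun t => u p0 t + eps * g p0 * expR (lam * t)) t0).
  - by apply: itv_dnbhs_proper => //; rewrite /= in_itv /= lexx ltW.
  - move=> t; rewrite /= in_itv /= => /andP[tl tr]; split => //.
    rewrite mulrAC ueq mulrAC; apply: uge; first exact: qI.
    by rewrite (le_trans (ltW th0))//= (le_trans tr)//; case/andP: t0J.
  - have he : deriv_at `[t0 / 2, t0] (fun t => expR (lam * t)) t0 (expR (lam * t0) * lam).
      apply: deriv_at_comp (is_derive_expR _).
      apply: (deriv_at_val (deriv_atM (deriv_at_cst _ lam t0) (deriv_at_id _ t0))).
      by rewrite /=; ring.
    have hu : `[t0 / 2, t0] `<=` (`]0, t1] : set R).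
      move=> t; rewrite /= !in_itv /= => /andP[tl tr].
      by rewrite (lt_le_trans th0)//= (le_trans tr)//; case/andP: t0J.
    apply: (deriv_at_val (deriv_atD (deriv_at_sub hu ut) (deriv_atM (deriv_at_cst _ (eps * g p0) t0) he))).
    by rewrite /E; ring.
have [/andP[al0 alM] beM uM kbM] := bounds (qI _ p0I) t0J.
(* At the touching point [u = - E g]; with [g >= 1] all terms below become comparable with [E g]. *)
have ueE : u p0 t0 = - (E * g p0) by rewrite uE v0 sub0r.
have h1 : - (2 * E * M) <= K2 * alpha p0 t0.
  apply: (@le_trans _ _ (- (2 * E) * alpha p0 t0)).
    by rewrite mulNr lerN2 ler_wpM2l// mulr_ge0// ltW.
  by apply: ler_wpM2r => //; lra.
have h2 : - (2 * E * ((b - a) * M)) <= - (K1 p0 t0 * beta p0 t0).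
  rewrite lerN2 (_ : K1 p0 t0 = 2 * E * - (p0 - m)); last by move: K1E; lra.
  rewrite -[_ * - _ * _]mulrA ler_wpM2l//; first by rewrite mulr_ge0// ltW.
  apply: (le_trans (ler_norm _)); rewrite normrM normrN ler_pM//.
  by rewrite ler_norml /m; case/andP: p0I => *; apply/andP; split; lra.
(* One factor of [u^2] is at most [M] in absolute value, the other equals [E g]; moreover
   [u - kb >= - 2 M]. *)
have h3 : - (2 * M ^+ 2 * (E * g p0)) <= u p0 t0 ^+ 2 * (u p0 t0 - kb t0).
  apply: (@le_trans _ _ (u p0 t0 ^+ 2 * - (2 * M))); last first.
    rewrite ler_wpM2l ?sqr_ge0//; move: uM; rewrite ler_norml => /andP[? ?]; lra.
  rewrite mulrN lerN2.
  have Eg0 : 0 <= E * g p0 by rewrite mulr_ge0// ltW.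
  have uu : u p0 t0 ^+ 2 <= M * (E * g p0).
    have nE : `|u p0 t0| = E * g p0 by rewrite ueE normrN ger0_norm.
    by rewrite -[u p0 t0 ^+ 2]real_normK ?num_real// expr2 {2}nE ler_wpM2r.
  rewrite (_ : 2 * M ^+ 2 * _ = M * (E * g p0) * (2 * M)); last by ring.
  by rewrite ler_wpM2r// mulr_ge0.
have h4 : (2 * M + 2 * (b - a) * M) * E <= (2 * M + 2 * (b - a) * M) * (E * g p0).
  rewrite ler_wpM2l//; last by rewrite ler_peMr// ltW.
  by rewrite addr_ge0// !mulr_ge0// subr_ge0 ltW.
have h5 : 0 < E * g p0 by rewrite mulr_gt0.
move: ut; rewrite -mulrA /lam leNgt => /negP; apply; lra.
Qed.

End MaxPrinciple.

(** * Solutions of the flow *)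

Section JointContinuity.
Context {R : realType}.

Lemma within_continuous_slice (I J : set R) (F : R * R -> R) (t : R) : J t ->
  {within I `*` J, continuous F} -> {within I, continuous (fun p => F (p, t))}.
Proof.
move=> Jt /subspace_continuousP cF; apply/subspace_continuousP => p Ip S FS.
have := cF (p, t) (conj Ip Jt) S FS; rewrite /nbhs /= /within /= => -[[U V] /= [pU tV] UV].
apply: (@filterS _ (nbhs p)) pU => q Uq Iq.
by apply: (UV (q, t)) => //; split=> //=; exact: nbhs_singleton.
Qed.

Lemma within_compact_bounded (D : set (R * R)) (F : R * R -> R) : compact D ->
  {within D, continuous F} -> exists2 M, 0 <= M & forall z, D z -> `|F z| <= M.
Proof.
move=> cD cF; have [M [_ hM]] := compact_bounded (continuous_compact cF cD).
exists (`|M| + 1); first by rewrite addr_ge0.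
move=> z Dz; apply: (hM (`|M| + 1) _ (F z)); last by exists z.
by rewrite (le_lt_trans (ler_norm M))// ltrDl.
Qed.

Variables (a b : R) (ab : a < b) (J : set R) (c : R -> R -> plane R).
Local Notation I := (`[a, b]%classic : set R).
Local Notation A := (dspace I c).
Local Notation B := (dspace I A).
Hypothesis hsA : has_dspace I J A.
Hypothesis jA : jointly_continuous I J A.
Hypothesis jB : jointly_continuous I J B.
Hypothesis creg : forall t, J t -> regular I (c ^~ t).

Lemma jointly_continuous_coords (d : R -> R -> plane R) : jointly_continuous I J d ->
  {within I `*` J, continuous (fun z => (d z.1 z.2).1)} /\
  {within I `*` J, continuous (fun z => (d z.1 z.2).2)}.
Proof.
move=> /subspace_continuousP jd; split; apply/subspace_continuousP => z Dz;
  by have /plane_cvgP[] := jd z Dz.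
Qed.

Lemma speed_jointly_continuous :
  {within I `*` J, continuous (fun z => speed I (c ^~ z.2) z.1)}.
Proof.
have [/subspace_continuousP A1 /subspace_continuousP A2] := jointly_continuous_coords jA.
apply/subspace_continuousP => z Dz.
apply: (@cvg_comp _ _ _ (fun z => (A z.1 z.2).1 * (A z.1 z.2).1 + (A z.1 z.2).2 * (A z.1 z.2).2) Num.sqrt).
  by apply: cvgD; apply: cvgM; [exact: A1|exact: A1|exact: A2|exact: A2].
exact: sqrt_continuous.
Qed.

Lemma invspeed_jointly_continuous :
  {within I `*` J, continuous (fun z => (speed I (c ^~ z.2) z.1)^-1)}.
Proof.
have /subspace_continuousP cs := speed_jointly_continuous.
apply/subspace_continuousP => z Dz; apply: cvgV; last exact: cs.
by case: Dz => Iz Jz; rewrite gt_eqF//; exact: (speed_gt0 (creg Jz)).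
Qed.

Lemma dots_jointly_continuous :
  {within I `*` J, continuous (fun z => (A z.1 z.2).1 * (B z.1 z.2).2 - (A z.1 z.2).2 * (B z.1 z.2).1)} /\
  {within I `*` J, continuous (fun z => (A z.1 z.2).1 * (B z.1 z.2).1 + (A z.1 z.2).2 * (B z.1 z.2).2)}.
Proof.
have [/subspace_continuousP A1 /subspace_continuousP A2] := jointly_continuous_coords jA.
have [/subspace_continuousP B1 /subspace_continuousP B2] := jointly_continuous_coords jB.
split; apply/subspace_continuousP => z Dz.
  by apply: cvgB; apply: cvgM; [exact: A1|exact: B2|exact: A2|exact: B1].
by apply: cvgD; apply: cvgM; [exact: A1|exact: B1|exact: A2|exact: B2].
Qed.

Lemma curvature_jointly_continuous :
  {within I `*` J, continuous (fun z => curvature I (c ^~ z.2) z.1)}.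
Proof.
have cr := invspeed_jointly_continuous; have [cX _] := dots_jointly_continuous.
have := within_continuousM cX (within_continuousM cr (within_continuousM cr cr)).
apply: subspace_eq_continuous => z; rewrite inE => -[Iz Jz]; rewrite /from_subspace /=.
have := curvatureE ab (fun q Iq => hsA Iq Jz) (creg Jz) Iz.
by move=> ->; rewrite !exprS expr0 mulr1.
Qed.

End JointContinuity.

(** * Length and mean curvature *)

Section MeanCurvature.
Context {R : realType}.
Variables (a b : R) (ab : a < b) (f : R -> plane R).
Local Notation I := (`[a, b]%classic : set R).
Hypothesis cs : {within I, continuous (speed I f)}.
Hypothesis ck : {within I, continuous (curvature I f)}.
Hypothesis s_gt0 : forall p, I p -> 0 < speed I f p.

Lemma length_antiderivative : exists F : R -> R, [/\ F a = 0, F b = length I f &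
  forall p, a <= p <= b -> deriv_at I F p (speed I f p)].
Proof.
have c1 : {within I, continuous (fun p => 1 * speed I f p)}.
  by apply: within_continuousM => //; exact: cst_continuous.
have [F [Fa Fb dF]] := antiderivative ab c1.
by exists F; split=> // p pI; apply: (deriv_at_val (dF p pI)); rewrite mul1r.
Qed.

Lemma length_ge (s0 : R) : (forall p, I p -> s0 <= speed I f p) -> s0 * (b - a) <= length I f.
Proof.
move=> hs0; have [F [Fa Fb dF]] := length_antiderivative.
have [x xab] := deriv_at_MVT ab dF; rewrite Fa Fb subr0 => ->.
rewrite ler_wpM2r ?subr_ge0 ?(ltW ab)//; apply: hs0.
by rewrite /= in_itv /=; case/andP: xab => *; rewrite !ltW.
Qed.

Lemma length_gt0 : 0 < length I f.
Proof.
have [F [Fa Fb dF]] := length_antiderivative.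
rewrite -Fb -Fa; apply: (deriv_at_gt0_lt ab dF) => x xab; apply: s_gt0.
by rewrite /= in_itv /=; case/andP: xab => *; rewrite !ltW.
Qed.

(** The primitive of [kappa - k0] times the speed is strictly increasing. This turns a strict
    boundary minimum of the curvature into an inequality with its mean. *)
Lemma mean_curvature_gt (k0 : R) :
  (forall q, a < q < b -> k0 < curvature I f q) -> k0 < mean_curvature I f.
Proof.
move=> hk0; rewrite /mean_curvature ltr_pdivlMr ?length_gt0//.
have [F [Fa Fb dF]] := length_antiderivative.
have cks : {within I, continuous (fun p => curvature I f p * speed I f p)}.
  exact: within_continuousM.
have [G [Ga Gb dG]] := antiderivative ab cks.
rewrite -subr_gt0.
have -> : total_curvature I f - k0 * length I f = G b - k0 * F b by rewrite Gb Fb.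
have -> : 0 = G a - k0 * F a by rewrite Ga Fa mulr0 subr0.
apply: (deriv_at_gt0_lt (f := fun p => G p - k0 * F p)
  (df := fun p => (curvature I f p - k0) * speed I f p) ab) => q qab.
  apply: (deriv_at_val (deriv_atB (dG q qab) (deriv_atM (deriv_at_cst I k0 q) (dF q qab)))).
  by move: (curvature I f q) (speed I f q) => *; ring.
rewrite mulr_gt0 ?subr_gt0 ?hk0// s_gt0//.
by rewrite /= in_itv /=; case/andP: qab => *; rewrite !ltW.
Qed.

(** The lower speed bound keeps the length away from zero; since [0 <= K], a smaller length only
    enlarges the quotient. *)
Lemma mean_curvature_le (s0 K : R) : 0 < s0 -> (forall p, I p -> s0 <= speed I f p) ->
  0 <= K -> total_curvature I f <= K -> mean_curvature I f <= K / (s0 * (b - a)).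
Proof.
move=> s00 hs0 K0 tK; have L0 := length_gt0; have hL := length_ge hs0.
have d0 : 0 < s0 * (b - a) by rewrite mulr_gt0// subr_gt0.
apply: (@le_trans _ _ (K / length I f)).
  by rewrite /mean_curvature ler_wpM2r// invr_ge0 ltW.
by rewrite ler_wpM2l// lef_pV2.
Qed.

End MeanCurvature.

(** * Infinitesimal form of a monotonicity inequality *)

Section BoundarySign.
Context {R : realType}.

(** Dividing by [(s - t) ^+ 2] keeps the sign on both sides of [t] and leaves a sum of products of
    difference quotients. *)
Lemma deriv_at_dot_ge0 (D : set R) (x1 x2 n1 n2 : R -> R) (t y1 y2 m1 m2 : R) :
  ProperFilter (within D t^') ->
  deriv_at D x1 t y1 -> deriv_at D x2 t y2 -> deriv_at D n1 t m1 -> deriv_at D n2 t m2 ->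
  (forall s, D s -> 0 <= (x1 s - x1 t) * (n1 s - n1 t) + (x2 s - x2 t) * (n2 s - n2 t)) ->
  0 <= y1 * m1 + y2 * m2.
Proof.
move=> PF /deriv_atE dx1 /deriv_atE dx2 /deriv_atE dn1 /deriv_atE dn2 h.
have hc : (fun s => (x1 s - x1 t) / (s - t) * ((n1 s - n1 t) / (s - t)) +
    (x2 s - x2 t) / (s - t) * ((n2 s - n2 t) / (s - t))) @ within D t^' --> y1 * m1 + y2 * m2.
  by apply: cvgD; apply: cvgM.
apply: (cvgr_to_ge hc); apply: near_within_dnbhs => s Ds st.
rewrite (_ : _ + _ = ((x1 s - x1 t) * (n1 s - n1 t) + (x2 s - x2 t) * (n2 s - n2 t)) / (s - t) ^+ 2).
  by rewrite divr_ge0 ?h// sqr_ge0.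
by field; rewrite subr_eq0.
Qed.

End BoundarySign.

(** * Preservation of convexity and embeddedness *)

Section Solution.
Context {R : realType}.
Variables (sa sb : R) (sf : R -> plane R) (hS : support_curve sa sb sf).
Variables (a b : R) (ab : a < b) (c0 : R -> plane R) (T : \bar R) (c : R -> R -> plane R).
Hypothesis hc : apcsf_solution sa sb sf a b c0 T c.
Local Notation I := (`[a, b]%classic : set R).
Local Notation J := (time_ioo T).
Local Notation J0 := (time_ico T).
Local Notation A := (dspace I c).
Local Notation B := (dspace I A).
Local Notation D := (dtime J c).
Local Notation r p t := ((speed I (c ^~ t) p)^-1).
Local Notation kap p t := (curvature I (c ^~ t) p).
Local Notation kb t := (mean_curvature I (c ^~ t)).
Local Notation K1 := (curvature_dp a b c).

Let aI : I a. Proof. by rewrite /= in_itv /= lexx ltW. Qed.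
Let bI : I b. Proof. by rewrite /= in_itv /= lexx ltW. Qed.

Lemma solution_regular t : J t -> regular I (c ^~ t).
Proof. by move=> Jt; apply: (sol_regular hc); exact: time_ioo_ico. Qed.

Lemma solution_class : class_C I J 4 c.
Proof. exact: (sol_smooth hc). Qed.

Lemma solution_flow p t : I p -> J t ->
  D p t = (kap p t - kb t) *: normal I (c ^~ t) p.
Proof.
move=> Ip Jt; have [_ [_ ht _ _]] := solution_class.
by rewrite -(dtime_time_ioo ht Ip Jt); apply: (sol_flow hc) => //; exact: time_ioo_ico.
Qed.

Lemma solution_C2 : [/\ has_dspace I J0 c, has_dspace I J0 A,
  jointly_continuous I J0 A & jointly_continuous I J0 B].
Proof.
(* The exponent [1 / 2] is one admissible choice; its class gives the second-order regularity up to
   time 0. *)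
have al : 0 < (2^-1 : R) < 1 by rewrite invr_gt0 ltr0n invf_lt1// ltr1n.
by have [[h1 h2 _] [[_ h3 h4 _] _]] := sol_holder hc al.
Qed.

Lemma solution_speed_continuous t : J0 t -> {within I, continuous (speed I (c ^~ t))}.
Proof.
move=> Jt; have [_ _ jA _] := solution_C2.
exact: (within_continuous_slice Jt (speed_jointly_continuous jA)).
Qed.

Lemma solution_curvature_continuous t : J0 t -> {within I, continuous (curvature I (c ^~ t))}.
Proof.
move=> Jt; have [_ hsA jA jB] := solution_C2.
exact: (within_continuous_slice Jt (curvature_jointly_continuous ab hsA jA jB (sol_regular hc))).
Qed.

(* Monotonicity of the normals of a convex curve, divided by the square of the time step. *)
Lemma boundary_sign t : J t ->
  0 <= (kap a t - kb t) * K1 a t /\ (kap b t - kb t) * K1 b t <= 0.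
Proof.
move=> Jt.
have PF : ProperFilter (within J t^') by apply: nbhs_dnbhs_proper; exact: nbhs_time_ioo.
have [_ [_ ht _ _]] := solution_class.
have hp s : J s -> _ := fun Js => neumann_halfplanes hS
  (dot_tangent (solution_regular Js) aI) (dot_tangent (solution_regular Js) bI)
  (sol_boundary hc (time_ioo_ico Js)).
have hI s : J s -> supp_image sa sb sf (c a s) /\ supp_image sa sb sf (c b s).
  by move=> Js; have [h1 h2 _ _] := sol_boundary hc (time_ioo_ico Js).
have velE p (Ip : I p) := flow_velocity solution_flow Jt Ip.
have tanE p (Ip : I p) := tangent_evolution ab solution_class solution_regular solution_flow Jt Ip.
(* The sign [e] is 1 at [a] and -1 at [b]. The velocity and the time derivative of the tangent are
   multiples of the normal with inner product [r * (kappa - kbar) * K1]; the positive [r] is divided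
   out. *)
have sgn p : I p -> forall e : R,
  (forall s, J s -> 0 <= e * dot (c p s - c p t) (tangent I (c ^~ s) p - tangent I (c ^~ t) p)) ->
  0 <= e * ((kap p t - kb t) * K1 p t).
  move=> Ip e he; have [d1 d2] := dtime_deriv_at ht Ip Jt.
  have [v1 v2] := velE p Ip; have [t1 t2] := tanE p Ip.
  have := deriv_at_dot_ge0 PF (deriv_at_val d1 v1) (deriv_at_val d2 v2)
    (deriv_atM (deriv_at_cst J e t) t1) (deriv_atM (deriv_at_cst J e t) t2).
  have hd s : J s -> 0 <= ((c p s).1 - (c p t).1) * (e * (tangent I (c ^~ s) p).1 - e * (tangent I (c ^~ t) p).1)
     + ((c p s).2 - (c p t).2) * (e * (tangent I (c ^~ s) p).2 - e * (tangent I (c ^~ t) p).2).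
    move=> Js; have := he s Js; rewrite /dot.
    generalize (c p s) (c p t) (tangent I (c ^~ s) p) (tangent I (c ^~ t) p).
    by move=> -[x1 x2] [y1 y2] [z1 z2] [w1 w2] /=; congr (_ <= _); ring.
  move=> /(_ hd) H; rewrite -(pmulr_lge0 _ (x := r p t)); last first.
    by rewrite invr_gt0; exact: (speed_gt0 (solution_regular Jt) Ip).
  move: H; have := invspeed_sqr_flow solution_regular Jt Ip.
  generalize (A p t) (r p t) (kap p t) (kb t) (K1 p t) => u s k1 k2 k3 su.
  congr (_ <= _).
  rewrite -[RHS]mulr1 -su; ring.
split.
(* The half-plane at each of the two times contains the endpoint at the other time; adding both
   inequalities gives the required sign. The end [b] is analogous. *)
- rewrite -[leRHS]mul1r; apply: sgn => // s Js.
  have [hs1 _ _] := hp s Js; have [ht1 _ _] := hp t Jt.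
  have := hs1 _ (hI t Jt).1; have := ht1 _ (hI s Js).1.
  rewrite /dot; generalize (c a s) (c a t) (tangent I (c ^~ s) a) (tangent I (c ^~ t) a) => -[x1 x2] [y1 y2] [z1 z2] [w1 w2] /=.
  lra.
- rewrite -oppr_ge0 -mulN1r; apply: sgn => // s Js.
  have [_ hs1 _] := hp s Js; have [_ ht1 _] := hp t Jt.
  have := hs1 _ (hI t Jt).2; have := ht1 _ (hI s Js).2.
  rewrite /dot; generalize (c b s) (c b t) (tangent I (c ^~ s) b) (tangent I (c ^~ t) b) => -[x1 x2] [y1 y2] [z1 z2] [w1 w2] /=.
  lra.
Qed.

Hypothesis k0_ge0 : forall p, I p -> 0 <= kap p 0.
Hypothesis hK : forall t, J0 t -> total_curvature I (c ^~ t) < pi + pi / 2.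

(** The maximum principle is run on [[0, t1]]. Compactness bounds the curvature and the
    coefficients; the upper bound on the mean curvature comes from [hK] and the least speed over
    these times. *)
Lemma solution_curvature_ge0 t1 p1 : J0 t1 -> I p1 -> 0 <= kap p1 t1.
Proof.
move=> Jt1 Ip1; have [hs hsA jA jB] := solution_C2.
have creg := sol_regular hc.
have [t1_ge0 t1T] := Jt1.
have sub0 t : 0 <= t <= t1 -> J0 t.
  by move=> /andP[t0 tt1]; split=> //; apply: le_lt_trans t1T; rewrite lee_fin.
have subJ t : 0 < t <= t1 -> J t.
  by move=> /andP[t0 tt1]; split=> //; apply: le_lt_trans t1T; rewrite lee_fin.
have subK : I `*` `[0, t1]%classic `<=` I `*` J0.
  by move=> [p t] [Ip]; rewrite /= in_itv => tI; split=> //; exact: sub0.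
have cK : compact (I `*` `[0, t1]%classic) by apply: compact_setX; exact: segment_compact.
have ck := continuous_subspaceW subK (curvature_jointly_continuous ab hsA jA jB creg).
have cs := continuous_subspaceW subK (speed_jointly_continuous jA).
have cr := continuous_subspaceW subK (invspeed_jointly_continuous jA creg).
have cP := continuous_subspaceW subK (dots_jointly_continuous jA jB).2.
have cr2 := within_continuousM cr cr.
have [M1 M10 h1] := within_compact_bounded cK ck.
have [M2 M20 h2] := within_compact_bounded cK cr2.
have [M3 M30 h3] := within_compact_bounded cK (within_continuousM (within_continuousM cr2 cr2) cP).
have K0 : (I `*` `[0, t1]%classic) !=set0.
  by exists (p1, 0); split=> //; rewrite /= in_itv /= lexx.
have [[p0 t0]] := compact_EVT_min K0 cK cs.
rewrite inE => /subK[/= Ip0 Jt0] smin.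
pose s0 := speed I (c ^~ t0) p0.
have s00 : 0 < s0 by exact: (speed_gt0 (creg _ Jt0) Ip0).
pose M4 := (pi + pi / 2) / (s0 * (b - a)).
have pi0 := @pi_gt0 R.
have M40 : 0 <= M4.
  rewrite /M4 divr_ge0//; first by lra.
  by rewrite mulr_ge0 ?subr_ge0// ltW.
have inI p : a <= p <= b -> I p by rewrite /= in_itv.
have kbM t : 0 <= t <= t1 -> kb t <= M4.
  move=> tI; have Jt := sub0 _ tI.
  apply: (mean_curvature_le ab (solution_speed_continuous Jt) _ s00).
  - by move=> p Ip; exact: (speed_gt0 (creg _ Jt) Ip).
  - move=> p Ip; have Kz : (I `*` `[0, t1]%classic) (p, t) by split; last by rewrite /= in_itv.
    exact: (smin (p, t) (mem_set Kz)).
  - by lra.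
  - by apply: ltW; exact: hK.
have bc t : 0 < t <= t1 -> forall k, (forall q, a < q < b -> k < kap q t) -> k < kb t.
  move=> tI k; have Jt := time_ioo_ico (subJ _ tI).
  apply: (mean_curvature_gt ab (solution_speed_continuous Jt) (solution_curvature_continuous Jt)).
  by move=> p Ip; exact: (speed_gt0 (creg _ Jt) Ip).
pose M := M1 + M2 + M3 + M4.
have M0 : 0 <= M by rewrite /M !addr_ge0.
apply: (@neumann_max_principle R a b t1 M ab t1_ge0 M0 (fun p t => kap p t) K1
  (fun p t => r p t ^+ 2)
  (fun p t => r p t ^+ 4 * ((A p t).1 * (B p t).1 + (A p t).2 * (B p t).2)) (fun t => kb t)).
- exact: ck.
- by move=> p /inI; exact: k0_ge0.
- move=> p t /inI Ip tI; have tI0 : 0 <= t <= t1 by case/andP: tI => *; rewrite ltW.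
  have Kz : (I `*` `[0, t1]%classic) (p, t) by split=> //; rewrite /= in_itv.
  have H1 : `|kap p t| <= M1 := h1 _ Kz.
  have H2 : `|r p t * r p t| <= M2 := h2 _ Kz.
  have H3 : `|r p t * r p t * (r p t * r p t) *
    ((A p t).1 * (B p t).1 + (A p t).2 * (B p t).2)| <= M3 := h3 _ Kz.
  have H4 := kbM t tI0.
  have r2E : r p t ^+ 2 = r p t * r p t by rewrite expr2.
  have r4E : r p t ^+ 4 = r p t * r p t * (r p t * r p t) by rewrite -!expr2 -exprM.
  rewrite r4E; rewrite -r2E ger0_norm ?sqr_ge0// in H2.
  have [MM1 MM2 MM3 MM4] : [/\ M1 <= M, M2 <= M, M3 <= M & M4 <= M].
    by rewrite /M; clear -M10 M20 M30 M40; split; lra.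
  split; first by rewrite sqr_ge0 (le_trans H2).
  - exact: le_trans H3 MM3.
  - exact: le_trans H1 MM1.
  - exact: le_trans H4 MM4.
- move=> p t /inI Ip tI.
  exact: (curvature_dp_deriv ab solution_class solution_regular (subJ _ tI) Ip).
- move=> p t /inI Ip tI.
  have [K2 [e1 e2]] := curvature_evolution ab solution_class solution_regular solution_flow
    (subJ _ tI) Ip.
  exists K2; split; first exact: e1.
  by apply: (deriv_at_sub _ e2) => s; rewrite /= in_itv; exact: subJ.
(* Here [kap a t < kb t], so the first half of [boundary_sign] forces [K1 a t <= 0]. *)
- move=> t tI hq; have kk := bc t tI _ hq.
  have [sg _] := boundary_sign (subJ _ tI).
  by move: sg; rewrite nmulr_rge0// subr_lt0.
- move=> t tI hq; have kk := bc t tI _ hq.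
  have [_ sg] := boundary_sign (subJ _ tI).
  by move: sg; rewrite nmulr_rle0// subr_lt0.
- by move: Ip1; rewrite /= in_itv.
Qed.

Lemma solution_embedded t : J0 t -> embedded I (c ^~ t).
Proof.
move=> Jt; have [hs hsA jA jB] := solution_C2.
split; first exact: (sol_regular hc Jt).
have [B1 B2] := jointly_continuous_coords jB.
apply: (convex_arc_injective ab (fun p Ip => hs p t Ip Jt) (fun p Ip => hsA p t Ip Jt)
  (sol_regular hc Jt) (within_continuous_slice Jt B1) (within_continuous_slice Jt B2)
  hS (sol_boundary hc Jt)); last exact: hK.
by move=> p Ip; exact: solution_curvature_ge0.
Qed.

End Solution.

(** Relative derivatives see only values on [I]. This serves to transfer the sign of the initial
    curvature, as [c] at time 0 is prescribed only on [[a, b]]. *)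
Lemma curvature_ext (R : realType) (I : set R) (f g : R -> plane R) p :
  (forall q, I q -> f q = g q) -> I p -> curvature I f p = curvature I g p.
Proof.
move=> fg Ip.
have dE q : I q -> derive_in I f q = derive_in I g q by move=> Iq; exact: derive_in_ext.
have tE q : I q -> tangent I f q = tangent I g q.
  by move=> Iq; rewrite /tangent /arc_derive /speed (dE q Iq).
by rewrite /curvature /normal /arc_derive /speed (dE p Ip) (tE p Ip) (derive_in_ext tE Ip).
Qed.

Theorem proposition5p4 (R : realType)
  (sa sb : R) (sf : R -> plane R) (hSigma : support_curve sa sb sf)
  (a b : R) (hab : a < b)
  (c0 : R -> plane R) (hc0 : initial_curve sa sb sf a b c0)
  (T : \bar R) (hT : (0%:E < T)%E)
  (c : R -> R -> plane R) (hc : apcsf_solution sa sb sf a b c0 T c)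
  (hA : forall p, `[a, b]%classic p -> 0 < curvature `[a, b] c0 p)
  (hB : set_inj `[a, b] c0)
  (hC : in_outer_domain sa sb sf a b c0)
  (d : R) (hd : is_minimum (antipodal_distances sa sb sf) d)
  (hD : length `[a, b] c0 < d)
  (hK : forall t, time_ico T t ->
     total_curvature `[a, b] (c ^~ t) < pi + pi / 2) :
  forall t, time_ico T t -> embedded `[a, b] (c ^~ t).
Proof.
have kap0 p : `[a, b]%classic p -> 0 <= curvature `[a, b] (c ^~ 0) p.
  by move=> Ip; rewrite (curvature_ext (sol_initial hc) Ip); exact: ltW (hA p Ip).
exact: (solution_embedded hSigma hab hc kap0 hK).
Qed.
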